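(* Suppose that $f\in H^m(0,l)$ with $m\ge 1$ and that $\Psi_{k,M-1}(f)=\sum_{n=1}^{2^{k-1}}\sum_{m'=0}^{M-1}a_{n,m'}\psi_{n,m'}(x)$ is the best approximation of $f$ based on the Legendre wavelets. Then $$\|f-\Psi_{k,M-1}(f)\|_{L^2(0,l)}\le C\,(M-1)^{-m}\,|f|_{H^{0,m,M-1,k}(0,l)},$$ and for $1\le r\le m$, $$\|f-\Psi_{k,M-1}(f)\|_{H^r(0,l)}\le C\,(M-1)^{2r-\frac12-m}\,|f|_{H^{r,m,M-1,k}(0,l)},$$ where $C$ denotes a positive constant that is independent of $M$ and $k$ but depends on the length $l$.
   Context: Let $P_i$, $i=0,1,2,\dots$, denote the Legendre polynomial of degree $i$ on $[-1,1]$, given by $P_0(x)=1$, $P_1(x)=x$ and $iP_i(x)=(2i-1)xP_{i-1}(x)-(i-1)P_{i-2}(x)$ for $i\ge 2$, so that $\int_{-1}^1P_i(x)P_j(x)\,dx=\frac{2}{2i+1}\delta_{ij}$. For $k=1,2,3,\dots$ (the level of resolution), $n=1,2,\dots,2^{k-1}$ and $i=0,1,2,\dots$, the Legendre wavelets on $[0,l)$ are $$\psi_{n,i}(x)=2^{k/2}\sqrt{\tfrac{2i+1}{2l}}\;P_i\!\left(\tfrac{2^k}{l}x-2n+1\right)\quad\text{if }\tfrac{n-1}{2^{k-1}}l\le x<\tfrac{n}{2^{k-1}}l,$$ and $\psi_{n,i}(x)=0$ otherwise. The coefficients of the approximation are $a_{n,i}=\langle f,\psi_{n,i}\rangle=\int_0^l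 f(x)\psi_{n,i}(x)\,dx$. The Sobolev norm of integer order $s\ge 0$ in the interval $(a,b)$ is $\|f\|_{H^s(a,b)}=\left(\sum_{j=0}^s\|f^{(j)}\|_{L^2(a,b)}^2\right)^{1/2}$, where $f^{(j)}$ denotes the derivative of $f$ of order $j$, and $H^s(a,b)$ is the corresponding Sobolev space. For $0\le r\le m$, $M\ge 1$ and $k\ge 1$, the semi-norm of $f\in H^m(0,l)$ is $$|f|_{H^{r,m,M-1,k}(0,l)}=\left(\sum_{j=\min\{m,M\}}^m(2^k)^{2r-2j}\|f^{(j)}\|_{L^2(0,l)}^2\right)^{1/2}.$$
   Formalization: For k ≥ 2 the H^r(0,l) norm of f − Ψ is read as the root of the sum of squared H^r norms over the dyadic cells, since Ψ jumps at interior breakpoints; M ≥ 2 is assumed, since (M−1) to a negative power is undefined at M = 1 and the r = m = 1 bound fails there for f(x) = x. *)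

(* Defs.v *)
From HB Require Import structures.
From mathcomp Require Import all_boot all_order all_algebra.
From mathcomp Require Import all_classical all_reals all_analysis.
Set Implicit Arguments.
Unset Strict Implicit.
Unset Printing Implicit Defensive.
Import Order.TTheory GRing.Theory Num.Theory.
Import numFieldNormedType.Exports.
Local Open Scope classical_set_scope.
Local Open Scope ring_scope.

(* Functions on an interval are represented by total functions R -> R of which
   only the values on the open interval ]a, b[ matter. *)

Section Sobolev.
Context {R : realType}.
Implicit Types (a b : R) (f g : R -> R) (j s : nat).

Local Notation mu := (@lebesgue_measure R).

Definition L2norm a b f : \bar R :=
  'N[mu]_2%:E [EFin \o (f \_ `]a, b[)]%E.

Definition inL2 a b f : Prop := f \_ `]a, b[ \in Lfun mu 2%:E.

Definition test_function a b (phi : R -> R) : Prop :=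
  (forall n x, derivable (derive1n n phi) x 1) /\
  exists c d, [/\ a < c, d < b & forall x, x \notin `[c, d] -> phi x = 0].

(* Only used for f and g in L2, so that both integrals are meaningful. *)
Definition weak_derivative a b j f g : Prop :=
  forall phi, test_function a b phi ->
    \int[mu]_(x in `]a, b[) (f x * derive1n j phi x) =
    (-1) ^+ j * \int[mu]_(x in `]a, b[) (g x * phi x).

Definition in_sobolev a b s f : Prop :=
  inL2 a b f /\
  forall j, (j <= s)%N -> exists g, inL2 a b g /\ weak_derivative a b j f g.

(* The weak derivative is unique up to a null set; one representative is
   chosen. The value is irrelevant when no weak derivative exists in L2. *)
Definition wderiv a b j f : R -> R :=
  xget (cst 0) [set g | inL2 a b g /\ weak_derivative a b j f g].

(* The norm is +oo outside H^s(a, b), so a finite bound on it includes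
   membership in H^s(a, b). *)
Definition sobolev_norm a b s f : \bar R :=
  (if `[< in_sobolev a b s f >] then
     (\sum_(0 <= j < s.+1) L2norm a b (wderiv a b j f) ^+ 2) `^ 2^-1
   else +oo)%E.

End Sobolev.

Section Wavelets.
Context {R : realType}.
Implicit Types (l x : R) (k n i m r M : nat) (f : R -> R).

Local Notation mu := (@lebesgue_measure R).

(* i P_i = (2 i - 1) X P_(i-1) - (i - 1) P_(i-2), with i = j + 2 *)
Fixpoint legendre i : {poly R} :=
  match i with
  | 0 => 1
  | i'.+1 => match i' with
             | 0 => 'X
             | j.+1 => (j.+2%:R)^-1 *:
                 ((2 * j.+2 - 1)%N%:R *: ('X * legendre i')
                  - j.+1%:R *: legendre j)
             end
  end.

(* The n-th dyadic cell of [0, l[ at level k, 1 <= n <= 2^(k-1), goes from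
   breakpoint l k n.-1 to breakpoint l k n. *)
Definition breakpoint l k n : R := n%:R / 2 ^+ k.-1 * l.

Definition wavelet l k n i x : R :=
  if breakpoint l k n.-1 <= x < breakpoint l k n then
    2 `^ (k%:R / 2) * Num.sqrt ((2 * i%:R + 1) / (2 * l))
      * (legendre i).[2 ^+ k / l * x - 2 * n%:R + 1]
  else 0.

Definition wavelet_coef l k n i f : R :=
  \int[mu]_(x in `]0, l[) (f x * wavelet l k n i x).

(* Psi_{k,M-1}(f): the indexing uses M itself. *)
Definition wavelet_approx l k M f x : R :=
  \sum_(1 <= n < (2 ^ k.-1).+1) \sum_(0 <= i < M)
    wavelet_coef l k n i f * wavelet l k n i x.

(* For k >= 2 the approximation jumps at the interior breakpoints and hence has
   no weak derivative in L2(0, l): the H^s(0, l) norm of the error is the one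
   obtained by differentiating inside each cell (broken Sobolev norm). *)
Definition broken_sobolev_norm l k s f : \bar R :=
  ((\sum_(1 <= n < (2 ^ k.-1).+1)
     sobolev_norm (breakpoint l k n.-1) (breakpoint l k n) s f ^+ 2)
   `^ 2^-1)%E.

(* |f|_{H^{r,m,M-1,k}(0,l)}; the exponent of 2^k is an integer of any sign. *)
Definition wavelet_seminorm l r m M k f : \bar R :=
  ((\sum_(minn m M <= j < m.+1)
     (((2 ^+ k) ^ (2 * r%:Z - 2 * j%:Z))%R)%:E
       * L2norm 0 l (wderiv 0 l j f) ^+ 2) `^ 2^-1)%E.

Lemma sobolev_norm_ge0 (a b : R) s f : (0 <= sobolev_norm a b s f)%E.
Proof. by rewrite /sobolev_norm; case: ifP => // _; exact: poweR_ge0. Qed.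

Lemma broken_sobolev_norm1 l s f :
  broken_sobolev_norm l 1 s f = sobolev_norm 0 l s f.
Proof.
rewrite /broken_sobolev_norm big_nat1 /breakpoint /= expr0 divr1 mul0r.
rewrite invr1 !mul1r.
have := sobolev_norm_ge0 0 l s f.
case: (sobolev_norm 0 l s f) => [y|_|//].
  rewrite lee_fin => y0; rewrite -EFinM poweR_EFin -expr2.
  by rewrite -powR_mulrn// -powRrM mulfV ?pnatr_eq0// powRr1.
by rewrite mulyy poweRyr// invr_neq0// pnatr_eq0.
Qed.

End Wavelets.

(* Main.v *)
Require Import Defs.
From HB Require Import structures.
From mathcomp Require Import all_boot all_order all_algebra.
From mathcomp Require Import all_classical all_reals all_analysis.
From mathcomp Require Import measurable_realfun ring lra zify.
Set Implicit Arguments.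
Unset Strict Implicit.
Unset Printing Implicit Defensive.
Import Order.TTheory GRing.Theory Num.Theory.
Import numFieldNormedType.Exports.
Local Open Scope classical_set_scope.
Local Open Scope ring_scope.

(** The error estimate is local. On each of the [2 ^ k.-1] cells the wavelet
    approximation is the orthogonal projection of [f], in the mean, on the
    polynomials of degree less than [M] ([wavelet_approx_cell]), so it suffices
    to bound the error of the Legendre projection on an interval of length [h]
    with the right powers of [h] ([cell_error_weighted]), and to add up. All
    estimates bear on squared norms, and the Legendre polynomials are carried
    to the cell by an affine map, so that no integral is ever rescaled.

    Order zero. The Legendre polynomials [Q i] of the cell satisfy
    [(w (Q i)')' = - i (i + 1) Q i] with [w = (x - a) (b - x)]. Integrating by
    parts twice, the Legendre coefficients of [u] beyond rank [M] are
    [1 / (i (i + 1))] times those of [u'] on the [(Q i)'], which are orthogonal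
    for the weight [w]; Bessel's inequality bounds the error of [u] by
    [h / M] times the norm of [u'] ([cell_proj_poincare]). Subtracting from [u]
    a primitive of the projection of [u'] replaces this norm by the error of
    [u'] at rank [M - 1] ([jackson_step]), and iterating gives the factor
    [h ^ m / M ^ m] ([jackson]).

    Order [r >= 1]. The derivative of the projection of [u] is not the
    projection of [u'], but the norm of the difference is at most [M ^ (1/2)]
    times the error of [u'] ([cell_proj_derive_defect]): by integration by
    parts it only depends on the two boundary values of the error of [u], and
    these are smaller than a plain trace inequality predicts, because they can
    be read off by testing against [Q (M - 1) + Q M] and [Q (M - 1) - Q M]
    ([trace_bound]). Each further derivative of this polynomial costs a factor
    [M ^ 2 / h] ([inverse_inequality]). An induction on [r] gives the exponent
    [2 r - 1/2 - m] ([sobolev_error]). When [M < m], the same bound is used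
    with [M] in place of [m], and the derivatives of order greater than [M],
    which polynomials do not see, are kept as they are: this is why the
    semi-norm contains all the orders from [min m M] to [m].

    What has to be known of a function [u] with a weak derivative [v] is
    integration by parts against polynomials, with some boundary values, and
    density of polynomials ([sobolev_pair]). Both hold for the primitive of
    [v], the first by Fubini's theorem ([primitive_ibp]), the second by
    Bernstein's theorem for Hoelder functions ([bernstein_approx]); and [u] is
    this primitive plus a constant, almost everywhere, by the lemma of du
    Bois-Reymond ([weakly_constant]). The latter, and the uniqueness of weak
    derivatives, rest on the fundamental lemma of the calculus of variations
    ([fundamental_lemma]), for which smooth test functions are built from
    [exp (- 1 / x)]. *)

(** * Square integrable functions on an interval *)

Section SquareIntegrable.
Context {R : realType}.
Implicit Types (a b c : R) (f g h : R -> R).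
Local Notation mu := (@lebesgue_measure R).

Lemma measurable_oo a b :
  measurable (`]a, b[%classic : set (measurableTypeR R)).
Proof. exact: measurable_itv. Qed.
Hint Resolve measurable_oo : core.

(** Membership is defined through the extension by zero to the whole line,
    whereas all integrals below are taken on the interval. *)
Lemma inL2P a b f : inL2 a b f <->
  measurable_fun `]a, b[ f /\ mu.-integrable `]a, b[ (EFin \o (fun x => f x ^+ 2)).
Proof.
have sqr_restrict : (EFin \o (fun x => (f \_ `]a, b[) x ^+ 2)) =
    ((EFin \o (fun x => f x ^+ 2)) \_ `]a, b[).
  apply/funext => x /=; rewrite !patchE; case: ifP => //= _; by rewrite expr0n.
have intE := @integrable_mkcond _ _ _ mu _ (EFin \o (fun x => f x ^+ 2))
  (measurable_oo a b).
split.
  move=> If; have := Lfun2_integrable_sqr If.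
  rewrite sqr_restrict => fi; split; last by rewrite intE.
  move: If; rewrite /inL2 inE => /andP[/[!inE]/= mf _].
  by apply/(measurable_restrictT f (measurable_oo a b)).
case=> mf fi.
have mf' : measurable_fun setT (f \_ `]a, b[).
  by apply/(measurable_restrictT f (measurable_oo a b)).
apply/andP; split; first by rewrite inE.
rewrite inE /= /finite_norm unlock poweR_lty//.
move: fi; rewrite intE -sqr_restrict => fi.
have := integrable_lty measurableT fi; apply: le_lt_trans.
rewrite le_eqVlt; apply/orP; left; apply/eqP; apply: eq_integral => x _ /=.
by rewrite powR_mulrn ?normr_ge0// real_normK// num_real.
Qed.

Lemma inL2_measurable a b f : inL2 a b f -> measurable_fun `]a, b[ f.
Proof. by case/inL2P. Qed.

Lemma inL2_mul_integrable a b f g : inL2 a b f -> inL2 a b g ->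
  mu.-integrable `]a, b[ (EFin \o (fun x => f x * g x)).
Proof.
move=> /inL2P[mf If] /inL2P[mg Ig].
have := integrableD (measurable_oo a b) If Ig.
apply: le_integrable => //.
  by apply/measurable_EFinP; exact: measurable_funM.
move=> x _ /=; rewrite lee_fin [leRHS]ger0_norm ?addr_ge0 ?sqr_ge0//.
rewrite ler_norml; apply/andP; split; nra.
Qed.

Lemma inL2D a b f g : inL2 a b f -> inL2 a b g -> inL2 a b (f + g).
Proof.
move=> If Ig; apply/inL2P; split.
  by apply: measurable_funD; exact: inL2_measurable.
have := (inL2_mul_integrable If Ig); move/inL2P : If => [mf If].
move/inL2P : Ig => [mg Ig] Ifg.
have := integrableD (measurable_oo a b)
  (integrableD (measurable_oo a b) If Ig) (integrableZl (measurable_oo a b) 2 Ifg).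
apply: eq_integrable => // x _ /=; rewrite -!EFinM -!EFinD; congr EFin.
by rewrite fctD /=; ring.
Qed.

Lemma inL2Z a b c f : inL2 a b f -> inL2 a b (c *: f).
Proof.
move=> /inL2P[mf If]; apply/inL2P; split.
  by apply: measurable_funM => //; exact: measurable_cst.
have := integrableZl (measurable_oo a b) (c ^+ 2) If.
by apply: eq_integrable => // x _ /=; rewrite -!EFinM fctZ /= exprMn.
Qed.

Lemma inL2N a b f : inL2 a b f -> inL2 a b (- f).
Proof. by rewrite -scaleN1r; exact: inL2Z. Qed.

Lemma inL2B a b f g : inL2 a b f -> inL2 a b g -> inL2 a b (f - g).
Proof. by move=> If Ig; apply: inL2D => //; exact: inL2N. Qed.

Lemma inL2_mul_bounded a b f g (M : R) : inL2 a b f ->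
  measurable_fun `]a, b[ g -> (forall x, a < x < b -> `|g x| <= M) ->
  inL2 a b (g * f).
Proof.
move=> /inL2P[mf If] mg gM; apply/inL2P; split; first exact: measurable_funM.
have := integrableZl (measurable_oo a b) (M ^+ 2) If.
apply: le_integrable => //.
  apply/measurable_EFinP; apply: measurable_funX; exact: measurable_funM.
move=> x /=; rewrite in_itv /= => /gM gxM; rewrite lee_fin fctM /= exprMn.
rewrite normrM [leRHS]normrM ler_wpM2r ?normr_ge0//.
rewrite ger0_norm ?sqr_ge0// ger0_norm ?sqr_ge0//.
by rewrite -[leLHS]real_normK ?num_real// lerXn2r ?nnegrE ?normr_ge0 ?(le_trans _ gxM).
Qed.

Lemma inL2_cst a b c : inL2 a b (cst c).
Proof.
apply/inL2P; split; first exact: measurable_cst.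
rewrite (_ : _ \o _ = EFin \o cst (c ^+ 2))//.
apply: measurable_bounded_integrable => //.
  have : (mu `]a, b[ < +oo)%E; last exact.
  by rewrite lebesgue_measure_itv /=; case: ifP => // _; rewrite ltry.
exists `|c ^+ 2|; split; first by rewrite num_real.
by move=> x cx y _ /=; exact: ltW.
Qed.

Lemma inL2_integrable a b f : inL2 a b f -> mu.-integrable `]a, b[ (EFin \o f).
Proof.
move=> If; have := inL2_mul_integrable If (inL2_cst a b 1).
by apply: eq_integrable => // x _ /=; rewrite mulr1.
Qed.

Lemma inL2_sub a b a' b' f : a <= a' -> b' <= b -> inL2 a b f -> inL2 a' b' f.
Proof.
move=> aa' bb' /inL2P[mf If].
have sub : (`]a', b'[%classic : set R) `<=` `]a, b[%classic.
  by apply: subset_itv; rewrite bnd_simp.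
apply/inL2P; split; first exact: measurable_funS mf.
exact: integrableS If.
Qed.

Lemma eq_inL2 a b f g : {in `]a, b[, f =1 g} -> inL2 a b f -> inL2 a b g.
Proof.
move=> fg; rewrite /inL2; suff -> : f \_ `]a, b[ = g \_ `]a, b[ by [].
apply/funext => x; rewrite !patchE; case: ifPn => //.
by rewrite inE => /= /fg.
Qed.

Definition ip a b f g : R := \int[mu]_(x in `]a, b[) (f x * g x).

(** The square of the $L^2$ norm: as a polynomial expression in [f], it behaves
    better than the norm under [ring] and induction. *)
Definition nsq a b f : R := ip a b f f.

Lemma ipC a b f g : ip a b f g = ip a b g f.
Proof. by apply: eq_Rintegral => x _; rewrite mulrC. Qed.

Lemma ipMA a b f g h : ip a b (f * g) h = ip a b f (g * h).
Proof. by apply: eq_Rintegral => x _; rewrite !fctM /= mulrA. Qed.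

Lemma ipDl a b f g h : inL2 a b f -> inL2 a b g -> inL2 a b h ->
  ip a b (f + g) h = ip a b f h + ip a b g h.
Proof.
move=> If Ig Ih; rewrite /ip -RintegralD//; try exact: inL2_mul_integrable.
by apply: eq_Rintegral => x _; rewrite fctD /= mulrDl.
Qed.

Lemma ipZl a b c f h : inL2 a b f -> inL2 a b h ->
  ip a b (c *: f) h = c * ip a b f h.
Proof.
move=> If Ih; rewrite /ip -RintegralZl//; last exact: inL2_mul_integrable.
by apply: eq_Rintegral => x _; rewrite fctZ /= mulrA.
Qed.

Lemma ipBl a b f g h : inL2 a b f -> inL2 a b g -> inL2 a b h ->
  ip a b (f - g) h = ip a b f h - ip a b g h.
Proof.
move=> If Ig Ih; rewrite ipDl//; last exact: inL2N.
by rewrite -scaleN1r ipZl// mulN1r.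
Qed.

Lemma ipDr a b f g h : inL2 a b f -> inL2 a b g -> inL2 a b h ->
  ip a b h (f + g) = ip a b h f + ip a b h g.
Proof. by move=> If Ig Ih; rewrite ![ip _ _ h _]ipC ipDl. Qed.

Lemma ipZr a b c f h : inL2 a b f -> inL2 a b h ->
  ip a b h (c *: f) = c * ip a b h f.
Proof. by move=> If Ih; rewrite ![ip _ _ h _]ipC ipZl. Qed.

Lemma ipBr a b f g h : inL2 a b f -> inL2 a b g -> inL2 a b h ->
  ip a b h (f - g) = ip a b h f - ip a b h g.
Proof. by move=> If Ig Ih; rewrite ![ip _ _ h _]ipC ipBl. Qed.

Lemma nsq_ge0 a b f : 0 <= nsq a b f.
Proof. by apply: Rintegral_ge0 => x _; rewrite -expr2 sqr_ge0. Qed.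

Lemma nsqZ a b c f : inL2 a b f -> nsq a b (c *: f) = c ^+ 2 * nsq a b f.
Proof. by move=> If; rewrite /nsq ipZl ?ipZr ?mulrA ?expr2//; exact: inL2Z. Qed.

Lemma nsqN a b f : nsq a b (- f) = nsq a b f.
Proof. by apply: eq_Rintegral => x _; rewrite fctN /= mulrNN. Qed.

Lemma nsqDE a b f g : inL2 a b f -> inL2 a b g ->
  nsq a b (f + g) = nsq a b f + 2 * ip a b f g + nsq a b g.
Proof.
move=> If Ig; have Ifg := inL2D If Ig.
rewrite /nsq ipDl// !ipDr// [ip a b g f]ipC; ring.
Qed.

(** [nsq (f + t g)] is nonnegative for every [t]; the general choice of [t] is
    the minimizer, and when [nsq g] vanishes the expression is affine in [t]. *)
Lemma cauchy_schwarz a b f g : inL2 a b f -> inL2 a b g ->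
  ip a b f g ^+ 2 <= nsq a b f * nsq a b g.
Proof.
move=> If Ig.
have P t : 0 <= nsq a b f + 2 * (t * ip a b f g) + t ^+ 2 * nsq a b g.
  rewrite -(nsqZ _ Ig) -(ipZr t Ig If) -nsqDE ?nsq_ge0//; exact: inL2Z.
have f0 := nsq_ge0 a b f.
have := nsq_ge0 a b g; rewrite le_eqVlt => /predU1P[g0|g0].
  rewrite -g0 mulr0; move: P; rewrite -g0 => P.
  set s := ip a b f g in P *; case: (eqVneq s 0) => [->|s0]; first by rewrite expr0n.
  exfalso; have := P (- (nsq a b f + 1) / s).
  by rewrite mulr0 addr0 divfK//; lra.
have := P (- ip a b f g / nsq a b g).
set s := ip a b f g; set G := nsq a b g in g0 *; set F := nsq a b f.
have -> : F + 2 * (- s / G * s) + (- s / G) ^+ 2 * G = (F * G - s ^+ 2) / G.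
  by field; rewrite gt_eqF.
by rewrite pmulr_lge0 ?invr_gt0// subr_ge0.
Qed.

Lemma nsqD_le a b f g : inL2 a b f -> inL2 a b g ->
  nsq a b (f + g) <= 2 * nsq a b f + 2 * nsq a b g.
Proof.
move=> If Ig; rewrite nsqDE//; have := nsq_ge0 a b (f - g).
rewrite nsqDE ?nsqN; [|by []|exact: inL2N].
by rewrite -scaleN1r ipZr//; lra.
Qed.

Lemma ip_null a b f g : inL2 a b f -> inL2 a b g -> nsq a b f = 0 -> ip a b f g = 0.
Proof.
move=> If Ig f0; have := cauchy_schwarz If Ig; rewrite f0 mul0r => s0.
by apply/eqP; rewrite -sqrf_eq0 eq_le s0 sqr_ge0.
Qed.

Lemma nsq_null_sub a b f g : inL2 a b f -> inL2 a b g -> nsq a b (f - g) = 0 ->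
  nsq a b f = nsq a b g.
Proof.
move=> If Ig fg0; rewrite -{1}[f](subrK g) nsqDE//; last exact: inL2B.
rewrite ip_null//; last exact: inL2B.
by rewrite fg0 mulr0 !add0r.
Qed.

Lemma L2norm_nsq a b f : inL2 a b f -> L2norm a b f = (Num.sqrt (nsq a b f))%:E.
Proof.
move=> If; have /inL2P[mf fi] := If.
rewrite /L2norm unlock /=.
have -> : (\int[mu]_x (`|(f \_ `]a, b[) x| `^ 2)%:E =
           \int[mu]_(x in `]a, b[) (f x ^+ 2)%:E)%E.
  rewrite [RHS]integral_mkcond; apply: eq_integral => x _.
  rewrite /= !patchE; case: ifP => _.
    by rewrite powR_mulrn ?normr_ge0// real_normK// num_real.
  by rewrite normr0 powR0 ?pnatr_eq0.
have -> : (\int[mu]_(x in `]a, b[) (f x ^+ 2)%:E = (nsq a b f)%:E)%E.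
  rewrite /nsq /ip /Rintegral fineK//; last first.
    have := integrable_fin_num (measurable_oo a b) fi.
    by under eq_integral do rewrite /= expr2.
by rewrite poweR_EFin powR12_sqrt// nsq_ge0.
Qed.

Lemma L2norm_sqr a b f : inL2 a b f -> (L2norm a b f ^+ 2 = (nsq a b f)%:E)%E.
Proof.
move=> If; rewrite L2norm_nsq// -EFin_expe sqr_sqrtr//; exact: nsq_ge0.
Qed.

Lemma inL2_mul_continuous a b f g : inL2 a b f -> continuous g -> inL2 a b (g * f).
Proof.
move=> If cf; have mf : measurable_fun `]a, b[ g.
  by apply: measurable_funS (continuous_measurable_fun cf).
have [ab|ba] := leP a b; last first.
  apply: (@inL2_mul_bounded _ _ _ _ 0) => // x /andP[ax xb].
  by have := lt_trans ba (lt_trans ax xb); rewrite ltxx.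
have [c1 _ Pc1] := @EVT_max R g a b ab (continuous_subspaceT cf).
have [c2 _ Pc2] := @EVT_min R g a b ab (continuous_subspaceT cf).
apply: (@inL2_mul_bounded _ _ _ _ (`|g c1| + `|g c2|)) => // x /andP[ax xb].
have xab : x \in `[a, b] by rewrite in_itv /= !ltW.
have := Pc1 _ xab; have := Pc2 _ xab => H1 H2; rewrite ler_norml.
have := ler_norm (g c1); have := ler_norm (- g c2); rewrite normrN.
have := normr_ge0 (g c1); have := normr_ge0 (g c2) => *.
by apply/andP; split; lra.
Qed.

Lemma inL2_continuous a b f : continuous f -> inL2 a b f.
Proof. by move=> cf; rewrite -[f]mulr1; exact: inL2_mul_continuous (inL2_cst a b 1) cf. Qed.

End SquareIntegrable.

(** * Smooth test functions *)

Section Smooth.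
Context {R : realType}.
Implicit Types (f g : R -> R) (n : nat) (p : {poly R}) (x y : R).

(** Iterating on the derivative, rather than differentiating the iterate as
    [derive1n] does, makes stability under products a plain induction. *)
Fixpoint nderivable n f : Prop :=
  if n is n'.+1 then (forall x, derivable f x 1) /\ nderivable n' (derive1 f) else True.

Lemma nderivableP f : (forall n x, derivable (derive1n n f) x 1) <->
  forall n, nderivable n f.
Proof.
have derive1nSr n h : derive1n n (derive1 h) = derive1n n.+1 h by rewrite /derive1n iterSr.
split=> H n.
  elim: n f H => //= n IH f H; split; first exact: (H 0).
  by apply: IH => k x; rewrite derive1nSr.
elim: n f H => [|n IH] f H x; first by have [] := H 1.
by rewrite -derive1nSr; apply: IH => k; have [] := H k.+1.
Qed.

Lemma nderivableW n f : nderivable n.+1 f -> nderivable n f.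
Proof. by elim: n f => // n IH f [? /IH H]; split. Qed.

Lemma nderivableD n f g : nderivable n f -> nderivable n g -> nderivable n (f + g).
Proof.
elim: n f g => //= n IH f g [df Df] [dg Dg]; split=> [x|]; first exact: derivableD.
rewrite (_ : derive1 (f + g) = (derive1 f) + (derive1 g)); first exact: IH.
by apply/funext => x; rewrite derive1E deriveD// -!derive1E.
Qed.

Lemma nderivableM n f g : nderivable n f -> nderivable n g -> nderivable n (f * g).
Proof.
elim: n f g => //= n IH f g [df Df] [dg Dg]; split=> [x|]; first exact: derivableM.
rewrite (_ : derive1 (f * g) = f * (derive1 g) + g * (derive1 f)).
  by apply: nderivableD; apply: IH => //; exact: nderivableW.
by apply/funext => x; rewrite derive1E deriveM// -!derive1E.
Qed.

Lemma nderivable_cst n (c : R) : nderivable n (cst c).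
Proof.
elim: n c => //= n IH c; split=> [x|]; first exact: derivable_cst.
by rewrite (_ : derive1 _ = cst 0)//; apply/funext => x; rewrite derive1_cst.
Qed.

Lemma nderivableZ n (c : R) f : nderivable n f -> nderivable n (c *: f).
Proof.
by move=> nf; rewrite (_ : c *: f = cst c * f)//; apply: nderivableM => //; exact: nderivable_cst.
Qed.

Lemma is_derive_affine (c d : R) x : is_derive x 1 (fun y => c * y + d) c.
Proof.
rewrite (_ : (fun y => _) = (c *: id + cst d))//.
by apply: is_derive_eq; rewrite addr0 /GRing.scale /= mulr1.
Qed.

Lemma nderivable_comp_affine n (c d : R) f : nderivable n f ->
  nderivable n (fun x => f (c * x + d)).
Proof.
elim: n f => //= n IH f [df Df].
have D x : is_derive x 1 (fun x => f (c * x + d)) (c * (derive1 f) (c * x + d)).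
  have H := is_derive_affine c d x.
  have H2 : is_derive ((fun y => c * y + d) x) 1 f ((derive1 f) (c * x + d)).
    by rewrite derive1E; apply: derivableP.
  rewrite mulrC; exact: (@is_derive1_comp _ f (fun y => c * y + d) _ _ _ H2 H).
split=> [x|]; first by have [] := D x.
rewrite (_ : derive1 _ = c *: (fun x => (derive1 f) (c * x + d))).
  by apply: nderivableZ; exact: IH.
by apply/funext => x; rewrite derive1E; have [_ ->] := D x.
Qed.

(** Since [y / n <= exp (y / n)], each [y ^ n] is at most [n ^ n exp y]. *)
Lemma horner_expN_bounded p : exists C : R, 0 <= C /\
  forall y, 0 < y -> `|p.[y]| * expR (- y) <= C.
Proof.
have mono n y : 0 < y -> y ^+ n * expR (- y) <= n%:R ^+ n.
  move=> y0; rewrite expRN ler_pdivrMr ?expR_gt0//.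
  case: n => [|n]; first by rewrite !expr0 mul1r -expR0 ler_expR ltW.
  have -> : expR y = expR (y / n.+1%:R) ^+ n.+1.
    by rewrite -expRM_natl mulrC divfK// pnatr_eq0.
  rewrite -exprMn; apply: lerXn2r; rewrite ?nnegrE ?mulr_ge0 ?expR_ge0 ?ler0n ?(ltW y0)//.
  rewrite mulrC -ler_pdivrMr ?ltr0n//; apply: le_trans (expR_ge1Dx _).
  by rewrite lerDr.
exists (\sum_(i < size p) `|p`_i| * i%:R ^+ i); split.
  by apply: sumr_ge0 => i _; rewrite mulr_ge0// exprn_ge0.
move=> y y0; rewrite horner_coef.
apply: (@le_trans _ _ ((\sum_(i < size p) `|p`_i * y ^+ i|) * expR (- y))).
  by rewrite ler_wpM2r ?expR_ge0// ler_norm_sum.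
rewrite mulr_suml; apply: ler_sum => i _; rewrite normrM -mulrA ler_wpM2l//.
by rewrite ger0_norm ?exprn_ge0 ?mono// ltW.
Qed.

(** The classical function that is flat at the origin. The polynomial factor in
    [1 / x] makes the family stable under derivation. *)
Definition flat p x : R := if 0 < x then p.[x^-1] * expR (- x^-1) else 0.

Definition flat_der p : {poly R} := 'X^2 * (p - (deriv p)).

(** At the origin the difference quotient is [h] times a value of
    [y ^ 2 p(y) exp (- y)], which is bounded. *)
Lemma is_derive_flat p x : is_derive x 1 (flat p) (flat (flat_der p) x).
Proof.
have [x0|x0|<-] := ltrgtP 0 x.
- have E : \forall y \near x, p.[y^-1] * expR (- y^-1) = flat p y.
    near=> y; rewrite /flat ifT//; near: y; exact: lt_nbhsr.
  have dV : is_derive x 1 (fun y => y^-1) (- x ^- 2).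
    by apply: is_derive_eq; [apply: is_deriveV; rewrite gt_eqF|rewrite scaler1].
  have dp : is_derive x 1 (fun y => p.[y^-1]) ((deriv p).[x^-1] * - x ^- 2).
    exact: (@is_derive1_comp _ (horner p) (fun y => y^-1) _ _ _ (is_derive_poly _ _) dV).
  have de : is_derive x 1 (fun y => expR (- y^-1)) (expR (- x^-1) * x ^- 2).
    apply: (@is_derive1_comp _ expR (fun y => - y^-1)).
    by apply: is_derive_eq; rewrite opprK.
  have := is_deriveM dp de.
  move=> H; apply: (near_eq_is_derive E).
  apply: is_derive_eq H _; rewrite /flat x0 /flat_der hornerM hornerXn hornerD hornerN
    /GRing.scale /= -exprVn; ring.
- have E : \forall y \near x, cst 0 y = flat p y.
    near=> y; rewrite /flat ifF//; apply/negbTE; rewrite -leNgt ltW//.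
    near: y; exact: lt_nbhsl.
  apply: (near_eq_is_derive E).
  by rewrite /flat ltNge (ltW x0) /=; exact: is_derive_cst.
- have [C [C0 PC]] := horner_expN_bounded ('X^2 * p).
  have f0 : flat p 0 = 0 by rewrite /flat ltxx.
  have flat0 q : flat q 0 = 0 by rewrite /flat ltxx.
  have L : h^-1 *: (flat p (h *: 1 + 0) - flat p 0) @[h --> 0^'] --> (0 : R).
    apply/cvgrPdist_le => e e0; near=> h.
    rewrite sub0r normrN addr0 f0 subr0 /GRing.scale /= mulr1 /flat.
    case: ifPn => hp; last by rewrite mulr0 normr0 ltW.
    have hi : 0 < h^-1 by rewrite invr_gt0.
    have := PC _ hi; rewrite !hornerE normrM (ger0_norm (exprn_ge0 _ (ltW hi))).
    move=> H; rewrite normrM normrM (gtr0_norm hi) (ger0_norm (expR_ge0 _)).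
    have -> : h^-1 * `|p.[h^-1]| * expR (- h^-1) =
        h * (h^-1 ^+ 2 * `|p.[h^-1]| * expR (- h^-1)).
      by field; rewrite gt_eqF.
    apply: (@le_trans _ _ (h * C)); first by rewrite ler_pM2l.
    apply: (@le_trans _ _ (h * (C + 1))); first by rewrite ler_pM2l ?lerDl.
    rewrite -ler_pdivlMr; last by rewrite ltr_wpDl.
    apply/ltW; apply: le_lt_trans (ler_norm _) _; near: h.
    apply: dnbhs0_lt; rewrite divr_gt0// ltr_wpDl//.
  rewrite flat0; split; last exact: (cvg_lim _ L).
  by apply/cvg_ex; exists 0.
Unshelve. all: by end_near.
Qed.

Lemma nderivable_flat n p : nderivable n (flat p).
Proof.
elim: n p => //= n IH p; split=> [x|]; first by have [] := is_derive_flat p x.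
rewrite (_ : derive1 _ = flat (flat_der p)); first exact: IH.
by apply/funext => x; rewrite derive1E; have [_ ->] := is_derive_flat p x.
Qed.

(** As [exp (- 1 / (n x))] tends to 1 for every positive [x], these smooth
    functions tend pointwise to the indicator of ]s, t[, from below. *)
Definition plateau (s t : R) n x : R :=
  flat 1 (n.+1%:R * (x - s)) * flat 1 (n.+1%:R * (t - x)).

Lemma plateau_test a b s t n : a < s -> t < b ->
  test_function a b (plateau s t n).
Proof.
move=> as_ tb; split.
  apply/nderivableP => k.
  rewrite (_ : plateau s t n = (fun x => flat 1 (n.+1%:R * x + - (n.+1%:R * s))) *
     (fun x => flat 1 (- n.+1%:R * x + n.+1%:R * t))); last first.
    by apply/funext => x; rewrite /plateau !mulrBr fctM /= mulNr [- _ + _]addrC.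
  by apply: nderivableM; apply: nderivable_comp_affine; exact: nderivable_flat.
exists s, t; split => // x; rewrite in_itv /= negb_and -!ltNge /plateau /flat => /orP[xs|xt].
  by rewrite ifF ?mul0r// pmulr_rgt0// subr_gt0 ltNge ltW.
by rewrite mulrC ifF ?mul0r// pmulr_rgt0// subr_gt0 ltNge ltW.
Qed.

Lemma flat1_ge0_le1 x : 0 <= flat 1 x <= 1.
Proof.
rewrite /flat; case: ifPn => [x0|_]; last by rewrite lexx ler01.
by rewrite hornerE mul1r expR_ge0 -expR0 ler_expR oppr_le0 invr_ge0 ltW.
Qed.

Lemma plateau_ge0_le1 s t n x : 0 <= plateau s t n x <= 1.
Proof.
have /andP[h0 h1] := flat1_ge0_le1 (n.+1%:R * (x - s)).
have /andP[k0 k1] := flat1_ge0_le1 (n.+1%:R * (t - x)).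
by rewrite /plateau mulr_ge0//= mulr_ile1.
Qed.

Lemma flat1_cvg y : 0 < y -> flat 1 (n.+1%:R * y) @[n --> \oo] --> (1 : R).
Proof.
move=> y0; rewrite (_ : (fun n => _) = (fun n => expR (- (y^-1 * n.+1%:R^-1)))); last first.
  apply/funext => n; rewrite /flat pmulr_rgt0// y0 hornerE mul1r invfM.
  by rewrite mulrC.
have H : (fun n => expR (- (y^-1 * n.+1%:R^-1))) @ \oo --> expR (- (y^-1 * 0)).
  apply: (cvg_comp _ expR); last exact: continuous_expR.
  by apply: cvgN; apply: cvgM; [exact: cvg_cst|exact: cvg_harmonic].
by rewrite mulr0 oppr0 expR0 in H.
Qed.

Lemma plateau_cvg s t x : plateau s t n x @[n --> \oo] --> (\1_(`]s, t[%classic) x : R).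
Proof.
rewrite indicE; case: (boolP (x \in _)); rewrite mem_setE in_itv /=.
  move=> /andP[sx xt]; rewrite -(mulr1 (true%:R)).
  by apply: cvgM; apply: flat1_cvg; rewrite subr_gt0.
rewrite negb_and -!leNgt => xst.
rewrite (_ : (fun n => _) = cst 0); first exact: cvg_cst.
apply/funext => n; rewrite /plateau /flat /=; case/orP: xst => H.
  by rewrite ifF ?mul0r// pmulr_rgt0// subr_gt0 ltNge H.
by rewrite mulrC ifF ?mul0r// pmulr_rgt0// subr_gt0 ltNge H.
Qed.

End Smooth.

(** * The fundamental lemma of the calculus of variations *)

Section FundamentalLemma.
Context {R : realType}.
Implicit Types (a b s t x y : R) (f g phi : R -> R).
Local Notation mu := (@lebesgue_measure R).

Lemma test_continuous a b phi : test_function a b phi -> continuous phi.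
Proof.
case=> /(_ 0) /= dphi _ x; apply: differentiable_continuous.
exact/derivable1_diffP.
Qed.

Lemma test_inL2 a b c d phi : test_function a b phi -> inL2 c d phi.
Proof. by move=> /test_continuous cphi; exact: inL2_continuous. Qed.

(** Dominated convergence along the plateaus of ]s, t[, which are test
    functions. *)
Lemma ortho_test_int0 a b g : inL2 a b g ->
  (forall phi, test_function a b phi -> ip a b g phi = 0) ->
  forall s t, a < s -> t < b -> ip a b g (\1_(`]s, t[%classic)) = 0.
Proof.
move=> Ig H s t as_ tb.
have [mD Ig1] := (measurable_oo a b, inL2_integrable Ig).
have mg := inL2_measurable Ig.
have mp n : measurable_fun `]a, b[ (plateau s t n).
  exact: inL2_measurable (test_inL2 _ _ (plateau_test n as_ tb)).
have mi : measurable_fun `]a, b[ (\1_(`]s, t[%classic) : R -> R).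
  by apply: measurable_indic; exact: measurable_itv.
have mf_ n : measurable_fun `]a, b[ (fun x => (g x * plateau s t n x)%:E).
  by apply/measurable_EFinP/measurable_funM.
have mf : measurable_fun `]a, b[ (fun x => (g x * \1_(`]s, t[%classic) x)%:E).
  by apply/measurable_EFinP/measurable_funM.
have cf x : (g x * plateau s t n x)%:E @[n --> \oo] --> (g x * \1_(`]s, t[%classic) x)%:E.
  apply: cvg_EFin; first exact: nearW.
  by apply: cvgM; [exact: cvg_cst|exact: plateau_cvg].
have dom x n : (`|(g x * plateau s t n x)%:E| <= `|(g x)%:E|)%E.
  have /andP[p0 p1] := plateau_ge0_le1 s t n x.
  by rewrite lee_fin normrM (ger0_norm p0) ler_piMr.
have aecf : {ae mu, forall x, `]a, b[%classic x ->
    (g x * plateau s t n x)%:E @[n --> \oo] --> (g x * \1_(`]s, t[%classic) x)%:E}.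
  by apply: aeW => x _; exact: cf.
have aedom : {ae mu, forall x n, `]a, b[%classic x ->
    (`|(g x * plateau s t n x)%:E| <= `|(g x)%:E|)%E}.
  by apply: aeW => x n _; exact: dom.
have [_ _ C] := dominated_convergence mD mf_ mf aecf (integrable_abse Ig1) aedom.
have int0 n : (\int[mu]_(x in `]a, b[) (g x * plateau s t n x)%:E)%E = 0%E.
  have := H _ (plateau_test n as_ tb); rewrite /ip /Rintegral => int0.
  rewrite -[LHS]fineK ?int0//; apply: integrable_fin_num => //.
  by apply: inL2_mul_integrable => //; exact: test_inL2 (plateau_test n as_ tb).
have {}C : (0%E : \bar R) @[_ --> \oo] -->
    (\int[mu]_(x in `]a, b[) (g x * \1_(`]s, t[%classic) x)%:E)%E.
  by apply: cvg_trans C; apply: near_eq_cvg; apply: nearW => n /=; rewrite int0.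
have := cvg_unique _ C (cvg_cst (0%E : \bar R)) => int1.
by rewrite /ip /Rintegral int1.
Qed.

(** By the previous lemma the primitive of [g] is constant on ]a, b[, and its
    derivative is [g] almost everywhere by Lebesgue's theorem. *)
Lemma fundamental_lemma a b g : inL2 a b g ->
  (forall phi, test_function a b phi -> ip a b g phi = 0) -> nsq a b g = 0.
Proof.
move=> Ig H.
have mD := measurable_oo a b.
(* Lebesgue differentiation is applied to the extension by zero. *)
pose g1 := g \_ `]a, b[.
have Ig1 : mu.-integrable setT (EFin \o g1).
  have := inL2_integrable Ig; rewrite (@integrable_mkcond _ _ _ mu _ _ mD).
  by rewrite restrict_EFin.
have Ig1y y : mu.-integrable `]-oo, y] (EFin \o g1).
  by apply: integrableS Ig1.
have lg1 : locally_integrable setT g1.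
  apply: open_integrable_locally => //; exact: openT.
have := FTC1Ny Ig1y lg1; set F := (fun x => _) => FTC.
have F0 s t : a < s -> s < t -> t < b -> F t = F s.
  move=> as_ st tb; apply/eqP; rewrite -subr_eq0; apply/eqP.
  rewrite (Rintegral_itvB (Ig1y t)) ?bnd_simp ?ltW//.
  rewrite -(ortho_test_int0 Ig H as_ tb) -Rintegral_itv_bndo_bndc; last first.
    by apply: integrableS Ig1.
  rewrite /ip Rintegral_mkcond [RHS]Rintegral_mkcond; apply: eq_Rintegral => x _.
  rewrite !patchE indicE /g1 patchE !mem_setE; case: ifPn => xst.
    have -> : x \in `]a, b[ by move: xst; rewrite !in_itv /=; lra.
    by rewrite mulr1.
  by rewrite mulr0 if_same.
have ae0 : {ae mu, forall x, `]a, b[%classic x -> g x = 0}.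
  move: FTC; apply: filterS; first exact: (ae_filter_ringOfSetsType mu).
  move=> x [_ dFx] xab; have /andP[ax xb] : a < x < b by move: xab; rewrite /= in_itv.
  have <- : g1 x = g x by rewrite /g1 patchE mem_set.
  rewrite -dFx derive1E (@near_eq_derive _ _ _ _ (cst (F x))) ?derive_cst//.
  near=> y; have ay : a < y by near: y; exact: lt_nbhsr.
  have yb : y < b by near: y; exact: lt_nbhsl.
  have [xy|yx|->//] := ltgtP x y; first exact: F0.
  by rewrite /= (F0 y x).
rewrite /nsq /ip /Rintegral (_ : (\int[mu]_(x in `]a, b[) (g x * g x)%:E)%E = 0%E)//.
rewrite -(integral0 mu `]a, b[); apply: ae_eq_integral => //.
- apply/measurable_EFinP/measurable_funM; exact: inL2_measurable.
- move: ae0; apply: filterS; first exact: (ae_filter_ringOfSetsType mu).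
  by move=> x gx xab; rewrite gx// mulr0.
Unshelve. all: by end_near.
Qed.

End FundamentalLemma.

(** * Approximation by Bernstein polynomials *)

Section Bernstein.
Context {R : realType}.
Implicit Types (f g : nat -> R) (n : nat) (t : R).

(** The expectation of [f] at a binomial variable with [n] trials of probability
    ['X]; the recursion conditions on the first trial. *)
Fixpoint bernstein n f : {poly R} :=
  if n is n'.+1 then
    'X * bernstein n' (fun k => f k.+1) + (1 - 'X) * bernstein n' f
  else (f 0)%:P.

Lemma bernsteinS n f t : (bernstein n.+1 f).[t] =
  t * (bernstein n (fun k => f k.+1)).[t] + (1 - t) * (bernstein n f).[t].
Proof. by rewrite /= !hornerE. Qed.

Lemma bernstein_le n f g t : 0 <= t <= 1 -> (forall k, (k <= n)%N -> f k <= g k) ->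
  (bernstein n f).[t] <= (bernstein n g).[t].
Proof.
move=> /andP[t0 t1]; elim: n f g => [|n IH] f g fg.
  by rewrite /= !hornerE fg.
rewrite !bernsteinS; apply: lerD; apply: ler_wpM2l; rewrite ?subr_ge0//.
  by apply: IH => k kn; exact: fg.
by apply: IH => k kn; apply: fg; exact: leqW.
Qed.

(** The mean square deviation from [c] is the variance plus the square of the
    bias. *)
Lemma bernstein_quadratic n (A B c t : R) :
  (bernstein n (fun k => A + B * (k%:R - c) ^+ 2)).[t] =
  A + B * (n%:R * t * (1 - t) + (n%:R * t - c) ^+ 2).
Proof.
elim: n c => [|n IH] c; first by rewrite /= !hornerE; ring.
rewrite bernsteinS IH.
rewrite (_ : (fun k => _) = (fun k => A + B * (k%:R - (c - 1)) ^+ 2)).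
  by rewrite IH -[n.+1%:R]natr1; ring.
by apply/funext => k; rewrite -natr1; ring.
Qed.

(** A Hoelder function of exponent 1/2 satisfies
    [|H s - H t| <= e / 2 + C (s - t) ^ 2], and the expectation of the last term
    is at most [C / n]. *)
Lemma bernstein_approx01 (H : R -> R) (K e : R) : 0 <= K -> 0 < e ->
  (forall s t, 0 <= s <= 1 -> 0 <= t <= 1 -> (H s - H t) ^+ 2 <= K * `|s - t|) ->
  exists p : {poly R}, forall t, 0 <= t <= 1 -> `|H t - p.[t]| <= e.
Proof.
move=> K0 e0 HK.
(* If d = |H s - H t| exceeds e / 2, then d <= d (2 d / e) ^ 3 = 8 d ^ 4 / e ^ 3,
   where d ^ 4 is at most (K |s - t|) ^ 2. *)
pose C := 8 * K ^+ 2 / e ^+ 3.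
have C0 : 0 <= C by rewrite divr_ge0 ?mulr_ge0 ?exprn_ge0// ltW.
have loc s t : 0 <= s <= 1 -> 0 <= t <= 1 -> `|H s - H t| <= e / 2 + C * (s - t) ^+ 2.
  move=> s01 t01; have := HK _ _ s01 t01.
  rewrite -[(s - t) ^+ 2]real_normK ?num_real//.
  rewrite -[(H s - H t) ^+ 2]real_normK ?num_real//.
  have := normr_ge0 (H s - H t); have := normr_ge0 (s - t).
  move: `|H s - H t| `|s - t| => d z z0 d0 dKz.
  have [de|ed] := leP d (e / 2).
    by apply: (le_trans de); rewrite lerDl mulr_ge0 ?exprn_ge0.
  have d4 : d ^+ 4 <= (K * z) ^+ 2.
    by rewrite (_ : d ^+ 4 = (d ^+ 2) ^+ 2) ?lerXn2r ?nnegrE ?exprn_ge0 ?mulr_ge0// -exprM.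
  apply: (@le_trans _ _ (C * z ^+ 2)); last by rewrite lerDr; lra.
  rewrite /C mulrAC ler_pdivlMr ?exprn_gt0//.
  have e3 : e ^+ 3 <= (2 * d) ^+ 3.
    by rewrite lerXn2r ?nnegrE ?mulr_ge0 ?(ltW e0)//; lra.
  apply: (@le_trans _ _ (d * (2 * d) ^+ 3)); first by rewrite ler_wpM2l.
  rewrite exprMn in d4; rewrite (_ : d * (2 * d) ^+ 3 = 8 * d ^+ 4); last by ring.
  by rewrite -mulrA ler_wpM2l.
have [n nC] : exists n, 2 * C / e <= n.+1%:R.
  exists (Num.trunc (2 * C / e)); apply/ltW.
  by rewrite -addn1 truncnS_gt ?divr_ge0// ?mulr_ge0// ltW.
exists (bernstein n.+1 (fun k => H (k%:R / n.+1%:R))) => t t01.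
have n0 : 0 < n.+1%:R :> R by rewrite ltr0n.
have k01 k : (k <= n.+1)%N -> 0 <= (k%:R / n.+1%:R : R) <= 1.
  by move=> kn; rewrite divr_ge0//= ler_pdivrMr// mul1r ler_nat.
have E : (forall k, (k%:R / n.+1%:R - t) ^+ 2 = (k%:R - n.+1%:R * t) ^+ 2 / n.+1%:R ^+ 2).
  by move=> k; field; rewrite gt_eqF.
have Q (A B : R) : (bernstein n.+1 (fun k => A + B / n.+1%:R ^+ 2 * (k%:R - n.+1%:R * t) ^+ 2)).[t]
    = A + B * (t * (1 - t) / n.+1%:R).
  by rewrite bernstein_quadratic; field; rewrite gt_eqF.
have V : C * (t * (1 - t) / n.+1%:R) <= e / 2.
  rewrite mulrA ler_pdivrMr//.
  apply: (@le_trans _ _ C); first by rewrite ler_piMr//; move: t01 => /andP[]; nra.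
  by move: nC; rewrite ler_pdivrMr//; lra.
have up := @bernstein_le n.+1 (fun k => H (k%:R / n.+1%:R))
  (fun k => (H t + e / 2) + C / n.+1%:R ^+ 2 * (k%:R - n.+1%:R * t) ^+ 2) t t01.
have lo := @bernstein_le n.+1
  (fun k => (H t - e / 2) + - C / n.+1%:R ^+ 2 * (k%:R - n.+1%:R * t) ^+ 2)
  (fun k => H (k%:R / n.+1%:R)) t t01.
rewrite !Q in up lo; rewrite distrC ler_norml.
set q := (bernstein _ _).[t] in up lo *.
have {}up : q <= H t + e / 2 + C * (t * (1 - t) / n.+1%:R).
  apply: up => k /k01 k1; have := loc _ _ k1 t01; rewrite E ler_norml => /andP[_].
  by rewrite mulrA mulrAC; move: (C / _ * _) => z; lra.
have {}lo : H t - e / 2 + - C * (t * (1 - t) / n.+1%:R) <= q.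
  apply: lo => k /k01 k1; have := loc _ _ k1 t01; rewrite E ler_norml => /andP[+ _].
  by rewrite mulrA mulrAC !mulNr; move: (C / _ * _) => z; lra.
by move: up lo V; rewrite mulNr; move: (C * _) => z *; apply/andP; split; lra.
Qed.

Lemma bernstein_approx (a b : R) (F : R -> R) (K e : R) : a < b -> 0 <= K -> 0 < e ->
  (forall x y, a <= x <= b -> a <= y <= b -> (F x - F y) ^+ 2 <= K * `|x - y|) ->
  exists p : {poly R}, forall x, a <= x <= b -> `|F x - p.[x]| <= e.
Proof.
move=> ab K0 e0 FK; have ba : 0 < b - a by rewrite subr_gt0.
have [|s t s01 t01|p pP] := @bernstein_approx01 (fun t => F (a + (b - a) * t)) (K * (b - a)) e _ e0.
- by rewrite mulr_ge0// ltW.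
- have I r : 0 <= r <= 1 -> a <= a + (b - a) * r <= b by move=> /andP[r0 r1]; apply/andP; split; nra.
  apply: le_trans (FK _ _ (I _ s01) (I _ t01)) _.
  by rewrite opprD addrACA subrr add0r -mulrBr normrM (gtr0_norm ba) mulrA.
exists (p \Po ((b - a)^-1 *: ('X - a%:P))) => x /andP[ax xb].
have := pP ((x - a) / (b - a)).
have -> : a + (b - a) * ((x - a) / (b - a)) = x by field; rewrite gt_eqF.
rewrite horner_comp hornerZ hornerXsubC [_^-1 * _]mulrC; apply.
by apply/andP; split; [rewrite divr_ge0 ?subr_ge0// ltW|rewrite ler_pdivrMr// mul1r lerD2r].
Qed.

End Bernstein.

(** * Functions with null weak derivative *)

Section WeakDerivative.
Context {R : realType}.
Implicit Types (a b c s t x y : R) (f g phi psi W u v : R -> R).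
Local Notation mu := (@lebesgue_measure R).

Lemma test_functionB a b phi psi : test_function a b phi -> test_function a b psi ->
  test_function a b (phi - psi).
Proof.
case=> /nderivableP d1 [c1 [e1 [ac1 eb1 H1]]] [/nderivableP d2 [c2 [e2 [ac2 eb2 H2]]]].
split.
  apply/nderivableP => n; rewrite -scaleN1r.
  by apply: nderivableD => //; exact: nderivableZ.
exists (Order.min c1 c2), (Order.max e1 e2); split.
- by rewrite lt_min ac1.
- by rewrite gt_max eb1.
- move=> x; rewrite in_itv /= ge_min le_max negb_and !negb_or -!ltNge => H.
  have h1 : phi x = 0.
    by apply: H1; rewrite in_itv /= negb_and -!ltNge; case/orP: H => /andP[-> _] //; rewrite orbT.
  have h2 : psi x = 0.
    by apply: H2; rewrite in_itv /= negb_and -!ltNge; case/orP: H => /andP[_ ->] //; rewrite orbT.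
  by rewrite -[LHS]/(phi x - psi x) h1 h2 subr0.
Qed.

Lemma test_functionZ a b c phi : test_function a b phi -> test_function a b (c *: phi).
Proof.
case=> /nderivableP d1 [c1 [e1 [ac1 eb1 H1]]]; split.
  by apply/nderivableP => n; exact: nderivableZ.
by exists c1, e1; split => // x /H1 x0; rewrite fctE /= x0 scaler0.
Qed.

(** Outside the support the function vanishes on a whole neighbourhood. *)
Lemma test_function_derive1 a b phi : test_function a b phi -> test_function a b (derive1 phi).
Proof.
case=> d1 [c1 [e1 [ac1 eb1 H1]]]; split.
  by move=> n x; have := d1 n.+1 x; rewrite /derive1n iterSr.
exists c1, e1; split => // x xce.
rewrite derive1E (@near_eq_derive _ _ _ _ (cst 0)) ?derive_cst//.
move: xce; rewrite in_itv /= negb_and -!ltNge => /orP[xc|ex].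
  near=> y; apply: H1; rewrite in_itv /= negb_and -ltNge; apply/orP; left.
  near: y; exact: lt_nbhsl.
near=> y; apply: H1; rewrite in_itv /= negb_and -!ltNge; apply/orP; right.
near: y; exact: lt_nbhsr.
Unshelve. all: by end_near.
Qed.

Lemma test_function_endpoints a b phi : a < b -> test_function a b phi ->
  phi a = 0 /\ phi b = 0.
Proof.
move=> ab [_ [c [e [ac eb H]]]]; split; apply: H; rewrite in_itv /= negb_and -!ltNge.
  by rewrite ac.
by rewrite eb orbT.
Qed.

Lemma nsq_cst1 a b : a < b -> nsq a b (cst 1) = b - a.
Proof.
move=> ab; rewrite /nsq /ip.
rewrite (_ : (fun x => _) = cst 1); last by apply/funext => x /=; rewrite mulr1.
have -> := @Rintegral_cst _ _ _ mu `]a, b[ (measurable_oo a b) 1.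
have mab : mu `]a, b[ = (b - a)%:E by rewrite lebesgue_measure_itv /= lte_fin ab EFinB.
by rewrite mul1r -[RHS]/(fine (b - a)%:E) -mab.
Qed.

(** Otherwise the fundamental lemma would make the constant [1] null. *)
Lemma exists_test_int1 a b : a < b ->
  exists2 eta, test_function a b eta & ip a b (cst 1) eta = 1.
Proof.
move=> ab; have [[eta teta eta0]|H] :=
    pselect (exists2 eta, test_function a b eta & ip a b (cst 1) eta != 0).
  exists ((ip a b (cst 1) eta)^-1 *: eta); first exact: test_functionZ.
  by rewrite ipZr ?mulVf//; [exact: test_inL2 teta|exact: inL2_cst].
have /eqP : b - a = 0.
  rewrite -(nsq_cst1 ab); apply: fundamental_lemma; first exact: inL2_cst.
  move=> phi tphi; apply/eqP/negPn/negP => phi0; apply: H; by exists phi.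
by rewrite subr_eq0 gt_eqF.
Qed.

(** To the right of the support the primitive is the total integral, that is 0. *)
Lemma test_primitive a b phi : test_function a b phi -> ip a b (cst 1) phi = 0 ->
  exists2 Phi, test_function a b Phi & derive1 Phi = phi.
Proof.
move=> tphi phi0; have [dphi [c [e [ac eb H]]]] := tphi.
have out x : x \notin `]a, b[ -> phi x = 0.
  move=> xab; apply: H; move: xab; rewrite !in_itv /= !negb_and -!leNgt -!ltNge.
  by case/orP => ?; apply/orP; [left|right]; lra.
have restr : phi \_ `]a, b[ = phi.
  by apply/funext => x; rewrite patchE mem_setE; case: ifPn => // /out ->.
have Iphi : mu.-integrable setT (EFin \o phi).
  rewrite -restr -restrict_EFin -(@integrable_mkcond _ _ _ mu _ _ (measurable_oo a b)).
  exact: inL2_integrable (test_inL2 a b tphi).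
pose Phi x := \int[mu]_(t in `]-oo, x]) phi t.
have DPhi x : derivable Phi x 1 /\ derive1 Phi x = phi x.
  apply: (@continuous_FTC1 _ phi -oo%O x (x + 1)); rewrite ?ltrDl//.
  - by apply: integrableS Iphi.
  - by rewrite ltNyr.
  - exact: (test_continuous tphi).
have dPhi : derive1 Phi = phi by apply/funext => x; have [] := DPhi x.
exists Phi => //; split.
  case=> [|n] x; first by have [] := DPhi x.
  by rewrite /derive1n iterSr dPhi; exact: dphi.
exists c, e; split => // x; rewrite in_itv /= negb_and -!ltNge => xce.
rewrite /Phi Rintegral_mkcond; case/orP: xce => [xc|ex].
  rewrite (_ : _ \_ _ = cst 0); first by rewrite Rintegral_cst ?mul0r.
  apply/funext => y; rewrite patchE mem_setE in_itv /=; case: ifPn => // yx.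
  by apply: H; rewrite in_itv /= negb_and -!ltNge; apply/orP; left; lra.
rewrite (_ : _ \_ _ = phi).
  rewrite -restr -Rintegral_mkcond -phi0 /ip; apply: eq_Rintegral => y _.
  by rewrite mul1r.
apply/funext => y; rewrite patchE mem_setE in_itv /=; case: ifPn => // yx.
by rewrite H// in_itv /= negb_and -!ltNge; apply/orP; right; lra.
Qed.

(** Lemma of du Bois-Reymond. If [k] is the integral of [psi], then
    [psi - k eta] is the derivative of a test function, so that [W] tests [psi]
    as the constant [ip W eta] does. *)
Lemma weakly_constant a b W : a < b -> inL2 a b W ->
  (forall phi, test_function a b phi -> ip a b W (derive1 phi) = 0) ->
  exists c, nsq a b (W - cst c) = 0.
Proof.
move=> ab IW H; have [eta teta eta1] := exists_test_int1 ab.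
exists (ip a b W eta); apply: fundamental_lemma => [|psi tpsi].
  by apply: inL2B => //; exact: inL2_cst.
have I1 := inL2_cst a b 1.
have Ipsi := test_inL2 a b tpsi.
have Ieta := test_inL2 a b teta.
set k := ip a b (cst 1) psi.
have [||Phi tPhi dPhi] := @test_primitive a b (psi - k *: eta).
- by apply: test_functionB => //; exact: test_functionZ.
- by rewrite ipBr ?ipZr// ?eta1 ?mulr1 ?subrr//; exact: inL2Z.
have := H _ tPhi; rewrite dPhi ipBr ?ipZr//; last exact: inL2Z.
rewrite ipBl//; last exact: inL2_cst.
rewrite (_ : cst _ = ip a b W eta *: cst 1); last first.
  by apply/funext => x; rewrite fctE /= [RHS]mulr1.
by rewrite ipZl// -/k mulrC.
Qed.

End WeakDerivative.

(** * Primitives of square integrable functions *)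

Section Primitive.
Context {R : realType}.
Implicit Types (a b c s t x y : R) (f g phi psi u v : R -> R).
Local Notation mu := (@lebesgue_measure R).

(** Integrating the extension by zero over a half-line gives a function that is
    continuous on the whole line, without any condition on [x]. *)
Definition primitive a b g x : R := \int[mu]_(t in `]-oo, x]) ((g \_ `]a, b[) t).

Lemma restrict_integrable a b g : inL2 a b g -> mu.-integrable setT (EFin \o (g \_ `]a, b[)).
Proof.
move=> /inL2_integrable; rewrite (@integrable_mkcond _ _ _ mu _ _ (measurable_oo a b)).
by rewrite restrict_EFin.
Qed.

Lemma restrict_inL2 a b s t g : inL2 a b g -> inL2 s t (g \_ `]a, b[).
Proof.
move=> Ig; rewrite /inL2 in Ig *.
have -> : ((g \_ `]a, b[) \_ `]s, t[) = g \_ (`]s, t[ `&` `]a, b[).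
  by rewrite patch_setI.
have [sa bt] := (lexx s, lexx t).
rewrite (_ : _ `&` _ = `]Order.max s a, Order.min t b[%classic).
  apply: (@inL2_sub _ a b) => //; first by rewrite le_max lexx orbT.
  by rewrite ge_min lexx orbT.
apply/seteqP; split => x /=; rewrite !in_itv /= gt_max lt_min.
  by move=> [/andP[-> ->] /andP[-> ->]].
by move=> /andP[/andP[-> ->] /andP[-> ->]].
Qed.

Lemma primitiveB a b g x y : inL2 a b g -> x <= y ->
  primitive a b g y - primitive a b g x = ip x y (g \_ `]a, b[) (cst 1).
Proof.
move=> Ig xy; have I := restrict_integrable Ig.
have Iy : mu.-integrable `]-oo, y] (EFin \o (g \_ `]a, b[)) by apply: integrableS I.
rewrite /primitive (Rintegral_itvB Iy) ?bnd_simp// -Rintegral_itv_bndo_bndc.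
  by apply: eq_Rintegral => z _; rewrite mulr1.
by apply: integrableS I.
Qed.

Lemma nsq_restrict_le a b s t g : inL2 a b g -> nsq s t (g \_ `]a, b[) <= nsq a b g.
Proof.
move=> Ig; have Ig2 : mu.-integrable setT (EFin \o (fun x => (g \_ `]a, b[) x * (g \_ `]a, b[) x)).
  have := inL2_mul_integrable Ig Ig.
  rewrite (@integrable_mkcond _ _ _ mu _ _ (measurable_oo a b)); apply: eq_integrable => // x _ /=.
  by rewrite !patchE; case: ifP; rewrite //= mul0r.
have [mD mD'] := (measurable_oo s t, measurable_oo a b).
rewrite /nsq /ip Rintegral_mkcond [leRHS]Rintegral_mkcond; apply: le_Rintegral => //.
- rewrite -restrict_EFin -(@integrable_mkcond _ _ _ mu _ _ mD).
  by apply: integrableS Ig2.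
- by apply: eq_integrable Ig2 => // x _ /=; rewrite !patchE; case: ifP; rewrite //= mul0r.
- move=> x _; rewrite !patchE.
  by case: ifP => _; case: ifP => _; rewrite ?mul0r// -expr2 sqr_ge0.
Qed.

(** Cauchy-Schwarz between [x] and [y]. *)
Lemma primitive_hoelder a b g x y : inL2 a b g ->
  (primitive a b g x - primitive a b g y) ^+ 2 <= nsq a b g * `|x - y|.
Proof.
move=> Ig; wlog yx : x y / y < x => [H|].
  have [|xy|->] := ltgtP y x; first exact: H.
    by rewrite -sqrrN opprB distrC H.
  by rewrite !subrr expr0n normr0 mulr0.
rewrite primitiveB ?(ltW yx)// gtr0_norm ?subr_gt0//.
have Ir := restrict_inL2 y x Ig; have I1 := inL2_cst y x 1.
apply: le_trans (cauchy_schwarz Ir I1) _; rewrite nsq_cst1//.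
by rewrite ler_wpM2r ?subr_ge0 ?(ltW yx)//; exact: nsq_restrict_le.
Qed.

Lemma primitive_continuous a b g : inL2 a b g -> continuous (primitive a b g).
Proof.
move=> Ig x; apply/cvgrPdist_lt => e e0.
have K0 : 0 < nsq a b g + 1 by rewrite ltr_wpDl// nsq_ge0.
near=> y; rewrite -(ltr_pXn2r (ltn0Sn 1)) ?nnegrE ?(ltW e0)//.
rewrite real_normK ?num_real//; apply: le_lt_trans (primitive_hoelder _ _ Ig) _.
apply: (@le_lt_trans _ _ ((nsq a b g + 1) * `|x - y|)).
  by rewrite ler_wpM2r// lerDl.
rewrite mulrC -ltr_pdivlMr//; near: y; apply: cvgr_dist_lt; last first.
  by rewrite divr_gt0// exprn_gt0.
exact: cvg_id.
Unshelve. all: by end_near.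
Qed.

Lemma primitive_inL2 a b s t g : inL2 a b g -> inL2 s t (primitive a b g).
Proof. by move=> Ig; exact: inL2_continuous (primitive_continuous Ig). Qed.

Lemma int_derivative s t phi psi : s <= t -> (forall x, is_derive x 1 phi (psi x)) ->
  continuous psi -> \int[mu]_(x in `[s, t]) psi x = phi t - phi s.
Proof.
rewrite le_eqVlt => /predU1P[<-|st] dphi cpsi.
  by rewrite set_itv1 Rintegral_set1 subrr.
have cphi : continuous phi.
  move=> x; apply: differentiable_continuous; apply/derivable1_diffP.
  by have [] := dphi x.
rewrite /Rintegral (@continuous_FTC2 _ psi phi)//.
- exact: continuous_subspaceT.
- split; first by move=> x _; have [] := dphi x.
  + exact: cvg_at_right_filter (cphi s).
  + exact: cvg_at_left_filter (cphi t).
- by move=> x _; rewrite derive1E; have [_ ->] := dphi x.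
Qed.

(** Fubini's theorem for [psi x * g y] on the triangle [a < y <= x < b]. *)
Lemma primitive_ibp a b g phi psi : a < b -> inL2 a b g ->
  (forall x, is_derive x 1 phi (psi x)) -> continuous psi ->
  ip a b (primitive a b g) psi = ip a b g (cst (phi b) - phi).
Proof.
move=> ab Ig dphi cpsi.
pose g1 : R -> R := g \_ `]a, b[; pose psi1 : R -> R := psi \_ `]a, b[.
have Ig1 : mu.-integrable setT (EFin \o g1) := restrict_integrable Ig.
have Ipsi1 : mu.-integrable setT (EFin \o psi1).
  exact: restrict_integrable (inL2_continuous a b cpsi).
have mg1 : measurable_fun setT g1 by apply/measurable_EFinP; exact: measurable_int Ig1.
have mpsi1 : measurable_fun setT psi1 by apply/measurable_EFinP; exact: measurable_int Ipsi1.
(* The function I cuts out the half-plane y <= x; the extensions by zero of g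
   and psi take care of the rest of the triangle. *)
pose I x y : R := \1_(`]-oo, x]%classic) y.
have I01 x y : `|I x y| <= 1.
  by rewrite /I indicE; case: (_ \in _); rewrite ?normr1 ?normr0.
pose f (z : measurableTypeR R * measurableTypeR R) : \bar R :=
  (psi1 z.1 * (g1 z.2 * I z.1 z.2))%:E.
have fle x y : `|psi1 x * (g1 y * I x y)| <= `|psi1 x| * `|g1 y|.
  by rewrite normrM ler_wpM2l// normrM ler_piMr.
have mI : measurable_fun setT (fun z : measurableTypeR R * measurableTypeR R => I z.1 z.2).
  rewrite (_ : (fun z => _) = \1_[set z : measurableTypeR R * measurableTypeR R | z.2 <= z.1]).
    apply: measurable_indic.
    have := @measurable_fun_le _ _ _ [set: measurableTypeR R * measurableTypeR R] snd fst.
    by rewrite setTI; apply.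
  apply/funext => z; rewrite /I !indicE; congr (nat_of_bool _)%:R.
have mf : measurable_fun setT f.
  apply/measurable_EFinP; apply: measurable_funM.
    by apply: (measurableT_comp mpsi1); exact: measurable_fst.
  apply: measurable_funM => //.
  by apply: (measurableT_comp mg1); exact: measurable_snd.
have Inx x : mu.-integrable setT (fun y => f (x, y)).
  have := integrableZl measurableT (psi1 x) Ig1; apply: le_integrable => //.
    by apply: (measurableT_comp mf); exact: measurable_pair1.
  by move=> y _ /=; rewrite lee_fin [leRHS]normrM.
have Iny y : mu.-integrable setT (fun x => f (x, y)).
  have := integrableZl measurableT (g1 y) Ipsi1; apply: le_integrable => //.
    by apply: (measurableT_comp mf); exact: measurable_pair2.
  by move=> x _ /=; rewrite lee_fin [leRHS]normrM [leRHS]mulrC; exact: fle.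
have If : (mu \x mu)%E.-integrable setT f.
  apply/integrable12ltyP => //.
  pose K := \int[mu]_x `|g1 x|.
  have K0 : 0 <= K by exact: Rintegral_ge0.
  have EK : (\int[mu]_y (`|g1 y|)%:E = K%:E)%E.
    rewrite /K /Rintegral fineK//; apply: integrable_fin_num => //.
    exact: integrable_abse Ig1.
  have IK : mu.-integrable setT (fun x => K%:E * `|(psi1 x)%:E|)%E.
    by apply: integrableZl => //; exact: integrable_abse Ipsi1.
  apply: le_lt_trans (integrable_lty measurableT IK).
  apply: ge0_le_integral => //.
  - by move=> x _; exact: integral_ge0.
  - have maf : measurable_fun setT (abse \o f) by exact: measurableT_comp.
    apply: (measurable_fun_fubini_tonelli_F (abse \o f)) => // z; exact: abse_ge0.
  - by case/integrableP : IK.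
  - move=> x _; rewrite -EK muleC.
    rewrite -ge0_integralZl//; last first.
      by apply/measurable_EFinP; apply: measurableT_comp mg1.
    apply: ge0_le_integral => //.
    + by apply: measurableT_comp => //; exact: measurable_int (Inx x).
    + apply/measurable_EFinP; apply: measurable_funM => //.
      exact: measurableT_comp.
    + by move=> y _; rewrite lee_fin.
have inner1 x : (\int[mu]_y f (x, y) = (psi1 x * primitive a b g x)%:E)%E.
  rewrite -[LHS]fineK; last by apply: integrable_fin_num.
  congr EFin; rewrite -[LHS]/(\int[mu]_y (psi1 x * (g1 y * I x y))).
  have IgI : mu.-integrable setT (EFin \o (fun y => g1 y * I x y)).
    apply: le_integrable Ig1 => //.
      apply/measurable_EFinP; apply: measurable_funM => //.
      by apply: measurable_indic; exact: measurable_itv.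
    by move=> y _ /=; rewrite lee_fin normrM ler_piMr.
  rewrite RintegralZl//; congr (_ * _); rewrite /primitive [RHS]Rintegral_mkcond.
  apply: eq_Rintegral => y _; rewrite [RHS]patchE /I indicE.
  by case: ifP => _; rewrite ?mulr1 ?mulr0.
have inner2 y : (\int[mu]_x f (x, y) = (g1 y * (phi b - phi y))%:E)%E.
  rewrite -[LHS]fineK; last by apply: integrable_fin_num.
  congr EFin; rewrite -[LHS]/(\int[mu]_x (psi1 x * (g1 y * I x y))).
  case: (boolP (y \in `]a, b[)) => yab; last first.
    have -> : g1 y = 0 by rewrite /g1 patchE mem_setE (negbTE yab).
    rewrite mul0r (_ : (fun x => _) = cst 0); first by rewrite Rintegral_cst ?mul0r.
    by apply/funext => x; rewrite mul0r mulr0.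
  have [ay yb] : a < y /\ y < b by move: yab; rewrite in_itv /= => /andP[].
  rewrite -(int_derivative (ltW yb) dphi cpsi).
  have Iyb : mu.-integrable `[y, b] (EFin \o psi).
    apply: continuous_compact_integrable; first exact: segment_compact.
    exact: continuous_subspaceT.
  have Iyb' : mu.-integrable `[y, b[ (EFin \o psi).
    by apply: integrableS Iyb => //; apply: subset_itvl; rewrite bnd_simp.
  rewrite -RintegralZl// -Rintegral_itv_bndo_bndc; last first.
    have mD : measurable (`[y, b[%classic : set (measurableTypeR R)) by exact: measurable_itv.
    by have := integrableZl mD (g1 y) Iyb'; apply: eq_integrable.
  rewrite [RHS]Rintegral_mkcond; apply: eq_Rintegral => x _.
  rewrite /psi1 /I indicE !patchE !mem_setE !in_itv /= andbC.
  have [yx|xy] := leP y x; last by rewrite /= !mulr0.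
  by rewrite (lt_le_trans ay yx) mulr1 andbT /=; case: ifP => _; rewrite ?mul0r// mulrC.
have := Fubini If.
under eq_integral do rewrite inner1.
under [in RHS]eq_integral do rewrite inner2.
move=> /(congr1 fine) H; rewrite /ip Rintegral_mkcond [RHS]Rintegral_mkcond.
transitivity (\int[mu]_x (psi1 x * primitive a b g x)).
  apply: eq_Rintegral => x _; rewrite /psi1 !patchE; case: ifP => _; last by rewrite mul0r.
  by rewrite mulrC.
rewrite [LHS]H; apply: eq_Rintegral => x _; rewrite /g1 !patchE; case: ifP => _ //.
by rewrite mul0r.
Qed.

End Primitive.

(** * Integration by parts and density of polynomials *)

Section SobolevPair.
Context {R : realType}.
Implicit Types (a b c s t x y : R) (f g phi psi u v : R -> R) (p q : {poly R}).
Local Notation mu := (@lebesgue_measure R).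

Lemma horner_continuous p : continuous (horner p).
Proof. exact: continuous_horner. Qed.

Lemma inL2_horner a b p : inL2 a b (horner p).
Proof. exact: inL2_continuous (@horner_continuous p). Qed.

Lemma hornerDf p q : horner (p + q) = horner p + horner q.
Proof. by apply/funext => x; rewrite hornerD. Qed.

Lemma hornerZf c p : horner (c *: p) = c *: horner p.
Proof. by apply/funext => x; rewrite hornerZ. Qed.

Lemma hornerBf p q : horner (p - q) = horner p - horner q.
Proof. by apply/funext => x; rewrite hornerD hornerN. Qed.

Lemma hornerMf p q : horner (p * q) = horner p * horner q.
Proof. by apply/funext => x; rewrite hornerM. Qed.

Lemma horner0f : horner (0 : {poly R}) = 0.
Proof. by apply/funext => x; rewrite horner0. Qed.

Lemma is_derive_horner p x : is_derive x 1 (horner p) (deriv p).[x].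
Proof. exact: is_derive_poly. Qed.

Lemma ip_cst1 a b f : ip a b (cst 1) f = \int[mu]_(x in `]a, b[) f x.
Proof. by apply: eq_Rintegral => x _; rewrite mul1r. Qed.

Lemma ip_poly a b p : a < b -> ip a b (cst 1) (horner (deriv p)) = p.[b] - p.[a].
Proof.
move=> ab; have cp := @horner_continuous (deriv p).
rewrite ip_cst1 -(int_derivative (ltW ab) (is_derive_horner p) cp).
have I : mu.-integrable `[a, b] (EFin \o horner (deriv p)).
  apply: continuous_compact_integrable; first exact: segment_compact.
  exact: continuous_subspaceT.
rewrite Rintegral_itv_obnd_cbnd ?Rintegral_itv_bndo_bndc//.
  by apply: integrableS I => //; apply: subset_itvl; rewrite bnd_simp.
by apply: integrableS I => //; apply: subset_itv; rewrite bnd_simp.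
Qed.

(** All that the estimates use of a function [u] with weak derivative [v]. The
    boundary values [ua] and [ub] are those of the continuous representative
    of [u], of which only their role in integration by parts matters. *)
Record sobolev_pair a b u v (ua ub : R) : Prop := SobolevPair {
  pair_fun : inL2 a b u;
  pair_der : inL2 a b v;
  pair_ibp : forall p, ip a b v (horner p) + ip a b u (horner (deriv p)) =
    ub * p.[b] - ua * p.[a];
  pair_dense : forall e, 0 < e -> exists p, nsq a b (u - horner p) <= e
}.

(** By the lemma of du Bois-Reymond, [u] is a constant plus the primitive of
    [v], up to a null function. *)
Lemma weak_derivative_pair a b u v : a < b -> inL2 a b u -> inL2 a b v ->
  weak_derivative a b 1 u v -> exists ua ub, sobolev_pair a b u v ua ub.
Proof.
move=> ab Iu Iv wd; set P := primitive a b v.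
have IP : inL2 a b P by exact: primitive_inL2.
have ba : 0 < b - a by rewrite subr_gt0.
have [c uc] : exists c, nsq a b ((u - P) - cst c) = 0.
  apply: weakly_constant => // [|phi tphi]; first exact: inL2B.
  have tphi' := test_function_derive1 tphi.
  have Iphi := test_inL2 a b tphi; have Iphi' := test_inL2 a b tphi'.
  have := wd _ tphi; rewrite expr1 mulN1r => wd1.
  have dphi x : is_derive x 1 phi (derive1 phi x).
    by rewrite derive1E; apply: derivableP; have [d _] := tphi; exact: (d 0).
  rewrite ipBl// [ip a b u _]wd1 (primitive_ibp ab Iv dphi (test_continuous tphi')).
  have [_ ->] := test_function_endpoints ab tphi.
  rewrite (_ : cst 0 - phi = - phi); last by apply/funext => x; rewrite /= sub0r.
  by rewrite -(scaleN1r phi) ipZr// mulN1r; exact: subrr.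
have Ic := inL2_cst a b c; have I1 := inL2_cst a b 1.
have IuPc : inL2 a b ((u - P) - cst c) by apply: inL2B => //; exact: inL2B.
have uE q : ip a b u (horner q) = ip a b P (horner q) + c * ip a b (cst 1) (horner q).
  have Iq := inL2_horner a b q; have := ip_null IuPc Iq uc.
  rewrite !ipBl//; last exact: inL2B.
  rewrite (_ : cst c = c *: cst 1) ?ipZl//; last first.
    by apply/funext => x /=; rewrite fctZ /= [RHS]mulr1.
  by move=> /eqP; rewrite subr_eq0 subr_eq addrC => /eqP.
exists c, (c + ip a b (cst 1) v); split => //.
  move=> p; have Ip := inL2_horner a b p.
  rewrite uE ip_poly//.
  rewrite (primitive_ibp ab Iv (is_derive_horner p) (@horner_continuous (deriv p))).
  rewrite (_ : cst p.[b] = p.[b] *: cst 1); last first.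
    by apply/funext => x /=; rewrite fctZ /= [RHS]mulr1.
  rewrite ipBr ?ipZr//; last exact: inL2Z.
  by rewrite [ip a b v (cst 1)]ipC; ring.
(* A uniform error d costs d ^ 2 (b - a) in the square of the norm. *)
move=> e e0; pose d := Num.sqrt (e / (b - a)).
have d0 : 0 < d by rewrite sqrtr_gt0 divr_gt0.
have [p pP] := @bernstein_approx _ a b P (nsq a b v) d ab (nsq_ge0 _ _ _) d0
  (fun x y _ _ => primitive_hoelder x y Iv).
exists (p + c%:P); have Ip := inL2_horner a b p.
have IPp : inL2 a b (P - horner p) by exact: inL2B.
rewrite (_ : u - horner (p + c%:P) = ((u - P) - cst c) + (P - horner p)); last first.
  by apply/funext => x; rewrite hornerDf !fctE /= hornerC; ring.
rewrite nsqDE// ip_null// uc mulr0 !add0r.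
have -> : e = d ^+ 2 * nsq a b (cst 1).
  by rewrite nsq_cst1// sqr_sqrtr ?divfK ?gt_eqF ?ltW ?divr_gt0.
rewrite /nsq -[_ * ip _ _ _ _]ipZl// /ip; apply: le_Rintegral => //.
- exact: inL2_mul_integrable.
- by apply: inL2_mul_integrable => //; exact: inL2Z.
move=> x /=; rewrite in_itv /= => /andP[ax xb].
have axb : a <= x <= b by rewrite (ltW ax) ltW.
rewrite mulr1 [leRHS]mulr1 -expr2 -[leLHS]real_normK ?num_real//.
by rewrite lerXn2r ?nnegrE ?(ltW d0)//; exact: pP.
Qed.

Lemma poly_pair a b p : a < b ->
  sobolev_pair a b (horner p) (horner (deriv p)) p.[a] p.[b].
Proof.
move=> ab; split; [exact: inL2_horner|exact: inL2_horner| |].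
  move=> q; have := ip_poly (p * q) ab; rewrite derivM !hornerM => <-.
  rewrite hornerDf ipDr; [|exact: inL2_horner|exact: inL2_horner|exact: inL2_cst].
  by congr (_ + _); rewrite ip_cst1; apply: eq_Rintegral => x _; rewrite hornerM.
move=> e e0; exists p; rewrite subrr -(scale0r (cst 1)) nsqZ ?expr0n ?mul0r ?ltW//.
exact: inL2_cst.
Qed.

Lemma pairB a b u v ua ub u' v' ua' ub' :
  sobolev_pair a b u v ua ub -> sobolev_pair a b u' v' ua' ub' ->
  sobolev_pair a b (u - u') (v - v') (ua - ua') (ub - ub').
Proof.
move=> [Iu Iv ibp dense] [Iu' Iv' ibp' dense']; split; try exact: inL2B.
  move=> p; have [Ip Ip'] := (inL2_horner a b p, inL2_horner a b (deriv p)).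
  by rewrite !ipBl// !mulrBl; have := ibp p; have := ibp' p; lra.
move=> e e0; have e4 : 0 < e / 4 by rewrite divr_gt0.
have [p pP] := dense _ e4; have [p' pP'] := dense' _ e4; exists (p - p').
have [Ip Ip'] := (inL2_horner a b p, inL2_horner a b p').
rewrite hornerBf (_ : _ - _ = (u - horner p) + - (u' - horner p')); last first.
  by apply/funext => x; rewrite !fctE /=; ring.
apply: le_trans (nsqD_le _ _) _; [exact: inL2B|by apply/inL2N/inL2B|].
by rewrite nsqN; lra.
Qed.

End SobolevPair.

(** * Identities between Legendre polynomials *)

Arguments legendre {R} i : simpl never.

Section LegendreAlgebra.
Context {R : realType}.
Implicit Types (i j n : nat) (p q : {poly R}).
Local Notation P := (@legendre R).
Local Notation "n %:C" := ((n%:R : R)%:P) (at level 2, format "n %:C").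

Lemma natSC n : n.+1%:C = n%:C + 1.
Proof. by rewrite -natr1 polyCD. Qed.

Lemma legendreSS n : n.+2%:C * P n.+2 = (n%:C + n%:C + 3%:C) * ('X * P n.+1) - n.+1%:C * P n.
Proof.
have -> : P n.+2 = n.+2%:R^-1 *:
  ((2 * n.+2 - 1)%N%:R *: ('X * P n.+1) - n.+1%:R *: P n) by [].
rewrite mul_polyC scalerA divff ?pnatr_eq0// scale1r -!mul_polyC; congr (_ * _ - _).
rewrite (_ : (2 * n.+2 - 1)%N = (n + n + 3)%N); last by lia.
by rewrite !natrD !polyCD.
Qed.

(** Both relations are proved together: differentiating the three-term
    recurrence gives the first one from the second one at the previous rank,
    and then multiplying by ['X] gives the second one. *)
Lemma legendre_derivS n :
  deriv (P n.+1) = 'X * deriv (P n) + n.+1%:C * P n /\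
  'X * deriv (P n.+1) - deriv (P n) = n.+1%:C * P n.+1.
Proof.
elim: n => [|n [B C]].
  have [-> ->] : P 0 = 1 /\ P 1 = 'X by [].
  by rewrite derivX derivC; split; ring.
have Dn : deriv (P n) = 'X * deriv (P n.+1) - n.+1%:C * P n.+1 by rewrite -C; ring.
have Sr := legendreSS n.
have n2 : n.+2%:C != 0 :> {poly R} by rewrite polyC_eq0 pnatr_eq0.
have B' : deriv (P n.+2) = 'X * deriv (P n.+1) + n.+2%:C * P n.+1.
  apply: (mulfI n2); have := congr1 (@deriv R) Sr.
  rewrite derivB !derivM !derivD !derivC derivX !mul0r !add0r => ->.
  by rewrite Dn !natSC polyC0; ring.
split=> //; rewrite B'.
apply: (@eq_trans _ _ (n.+2%:C * ('X * P n.+1) - (deriv (P n.+1) - 'X * ('X * deriv (P n.+1))))).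
  by ring.
have -> : 'X * deriv (P n.+1) = n.+1%:C * P n.+1 + deriv (P n) by rewrite -C; ring.
by rewrite B Sr !natSC polyC0; ring.
Qed.

Lemma legendre_ode n :
  deriv ((1 - 'X ^+ 2) * deriv (P n)) = - (n%:C * n.+1%:C) * P n.
Proof.
case: n => [|n].
  have -> : P 0 = 1 by [].
  by rewrite derivC mulr0 deriv0 polyC0 mul0r oppr0 mul0r.
have [B C] := legendre_derivS n.
have -> : (1 - 'X ^+ 2) * deriv (P n.+1) = n.+1%:C * (P n - 'X * P n.+1).
  apply: (@eq_trans _ _ (deriv (P n.+1) - 'X * ('X * deriv (P n.+1)))); first by ring.
  have -> : 'X * deriv (P n.+1) = n.+1%:C * P n.+1 + deriv (P n) by rewrite -C; ring.
  by rewrite B; ring.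
rewrite derivM derivC mul0r add0r derivB derivM derivX.
have -> : deriv (P n) = 'X * deriv (P n.+1) - n.+1%:C * P n.+1 by rewrite -C; ring.
by rewrite !natSC; ring.
Qed.

Lemma legendre_horner_rec n x :
  n.+2%:R * (P n.+2).[x] = (2 * n%:R + 3) * (x * (P n.+1).[x]) - n.+1%:R * (P n).[x].
Proof.
have := congr1 (fun p => p.[x]) (legendreSS n).
rewrite hornerM hornerC hornerD hornerN !hornerM hornerX !hornerD !hornerC => ->.
by congr (_ * _ - _); ring.
Qed.

Lemma legendre_at1 n : (P n).[1] = 1.
Proof.
suff: (P n).[1] = 1 /\ (P n.+1).[1] = 1 by case.
elim: n => [|n [H1 H2]].
  have [-> ->] : P 0 = 1 /\ P 1 = 'X by [].
  by rewrite hornerX hornerC.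
split=> //; have n2 : n.+2%:R != 0 :> R by rewrite pnatr_eq0.
apply: (mulfI n2); rewrite legendre_horner_rec H1 H2 -!natr1; ring.
Qed.

Lemma legendre_atN1 n : (P n).[-1] = (-1) ^+ n.
Proof.
suff: (P n).[-1] = (-1) ^+ n /\ (P n.+1).[-1] = (-1) ^+ n.+1 by case.
elim: n => [|n [H1 H2]].
  have [-> ->] : P 0 = 1 /\ P 1 = 'X by [].
  by rewrite hornerX hornerC expr0 expr1.
split=> //; have n2 : n.+2%:R != 0 :> R by rewrite pnatr_eq0.
apply: (mulfI n2); rewrite legendre_horner_rec H1 H2 -!natr1 !exprS; ring.
Qed.

Lemma size_legendre n : size (P n) = n.+1.
Proof.
suff: size (P n) = n.+1 /\ size (P n.+1) = n.+2 by case.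
elim: n => [|n [H1 H2]].
  have [-> ->] : P 0 = 1 /\ P 1 = 'X by [].
  by rewrite size_polyX size_poly1.
split=> //.
have -> : P n.+2 = n.+2%:R^-1 *:
  ((2 * n.+2 - 1)%N%:R *: ('X * P n.+1) - n.+1%:R *: P n) by [].
have Pn0 : P n.+1 != 0 by rewrite -size_poly_gt0 H2.
have sX : size ((2 * n.+2 - 1)%N%:R *: ('X * P n.+1)) = n.+3.
  rewrite size_scale ?pnatr_eq0; last by lia.
  by rewrite mulrC size_mulX// H2.
rewrite size_scale ?invr_eq0 ?pnatr_eq0// size_polyDl ?sX// size_polyN.
by apply: leq_ltn_trans (size_scale_leq _ _) _; rewrite H1.
Qed.

End LegendreAlgebra.

(** * Legendre polynomials of a cell *)

Section CellLegendre.
Context {R : realType}.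
Implicit Types (a b c x : R) (u v : R -> R) (p q : {poly R}) (i j n : nat).

(** The affine map of [a, b] onto [-1, 1]. *)
Definition cell_chart a b : {poly R} :=
  (2 / (b - a)) *: 'X - ((a + b) / (b - a))%:P.

Definition cell_legendre a b n : {poly R} := legendre n \Po cell_chart a b.

(** In the coordinate [t] of the chart this is [1 - t ^ 2] times
    [(b - a) ^ 2 / 4], the factor that frees the eigenvalues in the Legendre
    equation from the length of the cell. *)
Definition cell_weight a b : {poly R} := ('X - a%:P) * (b%:P - 'X).

Lemma cell_chartE a b x : (cell_chart a b).[x] = (2 * x - a - b) / (b - a).
Proof. by rewrite !hornerE; ring. Qed.

Lemma cell_chart_right a b : a < b -> (cell_chart a b).[b] = 1.
Proof. by move=> ab; rewrite cell_chartE; field; rewrite subr_eq0 gt_eqF. Qed.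

Lemma cell_chart_left a b : a < b -> (cell_chart a b).[a] = -1.
Proof. by move=> ab; rewrite cell_chartE; field; rewrite subr_eq0 gt_eqF. Qed.

Lemma deriv_cell_chart a b : deriv (cell_chart a b) = (2 / (b - a))%:P.
Proof. by rewrite derivB derivZ derivX derivC subr0 alg_polyC. Qed.

Lemma cell_legendre_right a b n : a < b -> (cell_legendre a b n).[b] = 1.
Proof. by move=> ab; rewrite horner_comp cell_chart_right// legendre_at1. Qed.

Lemma cell_legendre_left a b n : a < b -> (cell_legendre a b n).[a] = (-1) ^+ n.
Proof. by move=> ab; rewrite horner_comp cell_chart_left// legendre_atN1. Qed.

Lemma size_cell_chart a b : a < b -> size (cell_chart a b) = 2.
Proof.
move=> ab; have h0 : 2 / (b - a) != 0 by rewrite mulf_neq0// invr_eq0 subr_eq0 gt_eqF.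
rewrite /cell_chart size_polyDl size_scale// size_polyX// size_polyN.
exact: leq_ltn_trans (size_polyC_leq1 _) _.
Qed.

Lemma size_cell_legendre a b n : a < b -> size (cell_legendre a b n) = n.+1.
Proof. by move=> ab; rewrite size_comp_poly2 ?size_legendre// size_cell_chart. Qed.

Lemma cell_weight_left a b : (cell_weight a b).[a] = 0.
Proof. by rewrite !hornerE; ring. Qed.

Lemma cell_weight_right a b : (cell_weight a b).[b] = 0.
Proof. by rewrite !hornerE; ring. Qed.

Lemma cell_weight_chart a b : a < b ->
  cell_weight a b = ((b - a) ^+ 2 / 4)%:P * (1 - cell_chart a b ^+ 2).
Proof.
move=> ab; have h0 : b - a != 0 by rewrite subr_eq0 gt_eqF.
have H : ((b - a) / 2)%:P * cell_chart a b = 'X - ((a + b) / 2)%:P.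
  rewrite /cell_chart mulrBr -mul_polyC mulrA -!polyCM.
  by congr (_ - _%:P); [rewrite (_ : _ / 2 * _ = 1) ?mul1r//; field|field].
have -> : ((b - a) ^+ 2 / 4)%:P * (1 - cell_chart a b ^+ 2) =
    ((b - a) ^+ 2 / 4)%:P - (((b - a) / 2)%:P * cell_chart a b) ^+ 2.
  rewrite exprMn -polyC_exp mulrBr mulr1; congr (_ - _%:P * _); by field.
rewrite H /cell_weight.
have -> : (b - a) ^+ 2 / 4 = ((b - a) / 2) ^+ 2 by field.
have -> : b%:P = ((a + b) / 2)%:P + ((b - a) / 2)%:P :> {poly R}.
  by rewrite -polyCD; congr polyC; field.
have -> : a%:P = ((a + b) / 2)%:P - ((b - a) / 2)%:P :> {poly R}.
  by rewrite -polyCB; congr polyC; field.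
by rewrite polyC_exp; ring.
Qed.

Lemma cell_legendre_ode a b n : a < b ->
  deriv (cell_weight a b * deriv (cell_legendre a b n)) =
  - (n%:R * n.+1%:R) *: cell_legendre a b n.
Proof.
move=> ab; have h0 : b - a != 0 by rewrite subr_eq0 gt_eqF.
rewrite /cell_legendre deriv_comp deriv_cell_chart cell_weight_chart//.
have -> : ((b - a) ^+ 2 / 4)%:P * (1 - cell_chart a b ^+ 2) *
    ((deriv (legendre n) \Po cell_chart a b) * (2 / (b - a))%:P) =
    ((b - a) / 2) *: (((1 - 'X ^+ 2) * deriv (legendre n)) \Po cell_chart a b).
  rewrite comp_polyM comp_polyB comp_polyC polyC1 rmorphXn /= comp_polyX.
  rewrite -mul_polyC (_ : (b - a) / 2 = (b - a) ^+ 2 / 4 * (2 / (b - a))); last by field.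
  by rewrite polyCM; ring.
rewrite derivZ deriv_comp deriv_cell_chart legendre_ode.
rewrite [_ * (2 / _)%:P]mulrC [(2 / _)%:P * _]mul_polyC scalerA (_ : (b - a) / 2 * _ = 1) ?scale1r; last by field.
by rewrite -polyCM -polyCN mul_polyC comp_polyZ.
Qed.

(** The image in the chart of the second relation of [legendre_derivS]. *)
Lemma cell_legendre_derivS a b n :
  cell_chart a b * deriv (cell_legendre a b n.+1) =
  (2 / (b - a) * n.+1%:R) *: cell_legendre a b n.+1 + deriv (cell_legendre a b n).
Proof.
have [_ C] := @legendre_derivS R n; have := congr1 (fun p => p \Po cell_chart a b) C.
rewrite /cell_legendre !deriv_comp deriv_cell_chart comp_polyB !comp_polyM comp_polyX comp_polyC.
move=> /eqP; rewrite subr_eq => /eqP E.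
by rewrite mulrA E mulrDl -mul_polyC polyCM; ring.
Qed.

End CellLegendre.

Section CellProduct.
Context {R : realType}.
Variables (a b : R) (ab : a < b).
Implicit Types (c x : R) (u v : R -> R) (p q : {poly R}) (i j n : nat).
Local Notation Q := (cell_legendre a b).
Local Notation w := (cell_weight a b).
Local Notation ipp p q := (ip a b (horner p) (horner q)).
Local Notation inL2p := (inL2_horner a b).

Lemma ip_hornerD u p q : inL2 a b u ->
  ip a b u (horner (p + q)) = ip a b u (horner p) + ip a b u (horner q).
Proof. by move=> Iu; rewrite hornerDf ipDr//; exact: inL2_horner. Qed.

Lemma ip_hornerZ u c p : inL2 a b u ->
  ip a b u (horner (c *: p)) = c * ip a b u (horner p).
Proof. by move=> Iu; rewrite hornerZf ipZr//; exact: inL2_horner. Qed.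

Lemma ip_horner0 u : inL2 a b u -> ip a b u (horner 0) = 0.
Proof. by move=> Iu; rewrite -(scale0r (0 : {poly R})) ip_hornerZ ?mul0r. Qed.

Lemma ip_horner_sum u (I : Type) (r : seq I) (F : I -> {poly R}) : inL2 a b u ->
  ip a b u (horner (\sum_(i <- r) F i)) = \sum_(i <- r) ip a b u (horner (F i)).
Proof.
move=> Iu; elim/big_rec2: _ => [|i y p _ <-]; first exact: ip_horner0.
exact: ip_hornerD.
Qed.

Lemma ipp_ibp p q : ipp (deriv p) q + ipp p (deriv q) = p.[b] * q.[b] - p.[a] * q.[a].
Proof. exact: (pair_ibp (poly_pair p ab)). Qed.

Lemma ipp_ode i j : ipp (w * deriv (Q i)) (deriv (Q j)) = i%:R * i.+1%:R * ipp (Q i) (Q j).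
Proof.
have := ipp_ibp (w * deriv (Q i)) (Q j); rewrite ![(w * _).[_]]hornerM cell_weight_left cell_weight_right.
rewrite !mul0r subr0 cell_legendre_ode// ipC ip_hornerZ; last exact: inL2p.
by rewrite [ipp (Q j) _]ipC; lra.
Qed.

(** Eigenvectors of the symmetric operator [p |-> (w p')'] for distinct
    eigenvalues. *)
Lemma cell_legendre_ortho i j : i != j -> ipp (Q i) (Q j) = 0.
Proof.
move=> ij; have : ipp (w * deriv (Q i)) (deriv (Q j)) = ipp (w * deriv (Q j)) (deriv (Q i)).
  by rewrite !hornerMf mulrC ipMA ipC.
rewrite !ipp_ode [ipp (Q j) _]ipC => /eqP; rewrite -subr_eq0 -mulrBl mulf_eq0.
case/orP; last by move/eqP.
rewrite subr_eq0 -!natrM eqr_nat => /eqP H.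
by exfalso; move/eqP: ij; apply; nia.
Qed.

Lemma cell_legendre_span n p : (size p <= n)%N ->
  exists c : nat -> R, p = \sum_(0 <= i < n) c i *: Q i.
Proof.
elim: n p => [|n IH] p sp.
  by exists (fun=> 0); rewrite big_nil; apply/eqP; rewrite -size_poly_eq0 -leqn0.
have sQ : size (Q n) = n.+1 by exact: size_cell_legendre.
pose d := p`_n / lead_coef (Q n).
have [|c cP] := IH (p - d *: Q n).
  apply/leq_sizeP => j nj; rewrite coefB coefZ.
  have [->|jn] := eqVneq j n.
    rewrite /d lead_coefE sQ /= divfK ?subrr//.
    have : lead_coef (Q n) != 0 by rewrite lead_coef_eq0 -size_poly_gt0 sQ.
    by rewrite lead_coefE sQ.
  have nj' : (n < j)%N by rewrite ltn_neqAle eq_sym jn.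
  by rewrite !nth_default ?mulr0 ?subr0 ?sQ// (leq_trans sp).
exists (fun i => if i == n then d else c i).
rewrite big_nat_recr //= eqxx -[LHS](subrK (d *: Q n)) cP; congr (_ + _).
by apply: eq_big_nat => i /andP[_ ni]; rewrite ltn_eqF.
Qed.

Lemma cell_legendre_low n p : (size p <= n)%N -> ipp (Q n) p = 0.
Proof.
move=> /cell_legendre_span[c ->]; rewrite ip_horner_sum; last exact: inL2p.
rewrite big_nat big1// => i /andP[_ ni]; rewrite ip_hornerZ; last exact: inL2p.
by rewrite cell_legendre_ortho ?mulr0// gtn_eqF.
Qed.

(** Integrate the derivative of [t Q ^ 2], where [t] is the chart: [t Q'] is a
    multiple of [n Q] plus a polynomial of lower degree, orthogonal to [Q]. *)
Lemma cell_legendre_norm n : (2 * n%:R + 1) * ipp (Q n) (Q n) = b - a.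
Proof.
have h0 : b - a != 0 by rewrite subr_eq0 gt_eqF.
(* Twice over the length is the derivative of the chart. *)
have key : (2 / (b - a)) * ((2 * n%:R + 1) * ipp (Q n) (Q n)) = 2; last first.
  by apply: (mulfI (_ : 2 / (b - a) != 0)); [rewrite mulf_neq0 ?invr_eq0|rewrite key; field].
have [r rn Er] : exists2 r : {poly R}, (size r <= n)%N &
    cell_chart a b * deriv (Q n) = (2 / (b - a) * n%:R) *: Q n + r.
  case: n => [|n]; last first.
    exists (deriv (Q n)); last exact: cell_legendre_derivS.
    have /lt_size_deriv : Q n != 0 by rewrite -size_poly_gt0 size_cell_legendre.
    by rewrite size_cell_legendre// => /ltnW.
  exists 0; first by rewrite size_poly0.
  have -> : Q 0 = 1 by rewrite /cell_legendre comp_polyC.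
  by rewrite derivC !mulr0 scale0r addr0.
have Q2 x : (cell_chart a b * (Q n * Q n)).[x] =
    (cell_chart a b).[x] * ((Q n).[x] * (Q n).[x]).
  by rewrite [LHS]hornerM [X in _ * X]hornerM.
have := ip_poly (cell_chart a b * (Q n * Q n)) ab.
rewrite !Q2 cell_legendre_left// cell_legendre_right// cell_chart_right// cell_chart_left//.
rewrite -(expr2 ((-1) ^+ n)) sqrr_sign => E.
apply: (@eq_trans _ _ (1 * (1 * 1) - (-1) * 1)); last by ring.
rewrite -E derivM deriv_cell_chart derivM.
have -> : (2 / (b - a))%:P * (Q n * Q n) + cell_chart a b * (deriv (Q n) * Q n + Q n * deriv (Q n)) =
   (2 / (b - a) * (2 * n%:R + 1)) *: (Q n * Q n) + 2 *: (Q n * r).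
  apply: (@eq_trans _ _ ((2 / (b - a))%:P * (Q n * Q n) + 2 * (Q n * (cell_chart a b * deriv (Q n))))).
    by ring.
  rewrite Er -!mul_polyC !polyCM !polyCD !polyCM; ring.
have I1 := inL2_cst a b 1.
rewrite ip_hornerD// !ip_hornerZ// !hornerMf ![ip a b (cst 1) _]ipC !ipMA.
have M1 (f : R -> R) : f * cst 1 = f by apply/funext => x; rewrite fctE /= mulr1.
by rewrite !M1 [X in _ + 2 * X]cell_legendre_low// mulr0 addr0; ring.
Qed.

End CellProduct.

(** * The Legendre projection and the estimate of order zero *)

Section Projection.
Context {R : realType}.
Variables (a b : R) (ab : a < b).
Implicit Types (c x : R) (u v : R -> R) (p q : {poly R}) (i j n M : nat).
Local Notation Q := (cell_legendre a b).
Local Notation w := (cell_weight a b).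
Local Notation h := (b - a).
Local Notation ipp p q := (ip a b (horner p) (horner q)).
Local Notation inL2p := (inL2_horner a b).

Definition cell_proj M u : {poly R} :=
  \sum_(0 <= i < M) ((2 * i%:R + 1) / h * ip a b u (horner (Q i))) *: Q i.

Let h0 : h != 0. Proof. by rewrite subr_eq0 gt_eqF. Qed.
Let hgt0 : 0 < h. Proof. by rewrite subr_gt0. Qed.

Let odd0 i : 2 * i%:R + 1 != 0 :> R.
Proof. by rewrite gt_eqF// ltr_wpDl ?mulr_ge0 ?ler0n. Qed.

Lemma nsq_cell_legendre i : ipp (Q i) (Q i) = h / (2 * i%:R + 1).
Proof. by have := cell_legendre_norm ab i => <-; rewrite mulrAC divff ?mul1r. Qed.

Lemma size_cell_sum M (c : nat -> R) : (size (\sum_(0 <= i < M) c i *: Q i)%R <= M)%N.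
Proof.
elim: M => [|M IH]; first by rewrite big_nil size_poly0.
rewrite big_nat_recr //=; apply: leq_trans (size_polyD _ _) _.
rewrite geq_max (leq_trans IH)//; apply: leq_trans (size_scale_leq _ _) _.
by rewrite size_cell_legendre.
Qed.

Lemma size_cell_proj M u : (size (cell_proj M u) <= M)%N.
Proof. exact: size_cell_sum. Qed.

Lemma ipp_cell_sum m M (c : nat -> R) j :
  ipp (\sum_(m <= i < M) c i *: Q i) (Q j) =
  if (m <= j < M)%N then c j * ipp (Q j) (Q j) else 0.
Proof.
have Ij := inL2p (Q j); rewrite ipC ip_horner_sum//.
under eq_bigr do rewrite ip_hornerZ//.
case: ifPn => [/andP[mj jM]|mjM].
  rewrite (bigD1_seq j) ?mem_index_iota ?mj ?iota_uniq//= big1 ?addr0// => i ij.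
  by rewrite cell_legendre_ortho ?mulr0// eq_sym.
rewrite big_nat big1// => i iM; rewrite cell_legendre_ortho ?mulr0//.
by apply: contraNneq mjM => ->.
Qed.

Lemma cell_proj_ortho M u q : inL2 a b u -> (size q <= M)%N ->
  ip a b (u - horner (cell_proj M u)) (horner q) = 0.
Proof.
move=> Iu /(cell_legendre_span ab)[c ->].
have Ie : inL2 a b (u - horner (cell_proj M u)) by apply: inL2B => //; exact: inL2p.
rewrite ip_horner_sum// big_nat big1// => i iM; rewrite ip_hornerZ//.
rewrite ipBl//; try exact: inL2p.
rewrite ipp_cell_sum iM nsq_cell_legendre.
by rewrite (_ : _ - _ = 0) ?mulr0//; field; rewrite odd0 h0.
Qed.

Lemma cell_proj_pythagoras M u q : inL2 a b u -> (size q <= M)%N ->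
  nsq a b (u - horner q) =
  nsq a b (u - horner (cell_proj M u)) + nsq a b (horner (cell_proj M u - q)).
Proof.
move=> Iu sq; have Ie : inL2 a b (u - horner (cell_proj M u)).
  by apply: inL2B => //; exact: inL2p.
rewrite (_ : u - horner q = (u - horner (cell_proj M u)) + horner (cell_proj M u - q)); last first.
  by rewrite hornerBf addrA subrK.
rewrite nsqDE//; last exact: inL2p.
rewrite cell_proj_ortho ?mulr0 ?addr0//.
apply: leq_trans (size_polyD _ _) _; rewrite size_polyN geq_max sq andbT.
exact: size_cell_proj.
Qed.

Lemma cell_proj_best M u q : inL2 a b u -> (size q <= M)%N ->
  nsq a b (u - horner (cell_proj M u)) <= nsq a b (u - horner q).
Proof. by move=> Iu sq; rewrite (cell_proj_pythagoras Iu sq) lerDl nsq_ge0. Qed.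

Lemma cell_projB M K u : (M <= K)%N -> cell_proj K u - cell_proj M u =
  \sum_(M <= i < K) ((2 * i%:R + 1) / h * ip a b u (horner (Q i))) *: Q i.
Proof.
by move=> MK; rewrite /cell_proj (@big_cat_nat _ _ _ M)//= addrAC subrr add0r.
Qed.

(** Let [s] be the part of the Legendre expansion of [u] between the ranks [M]
    and [K]. The operator [p |-> - (w p')'] multiplies its coefficients by
    [i (i + 1) >= M ^ 2], whence [M ^ 2 nsq s <= ip s' (w s')]. Integrating by
    parts, [ip v (w s') = ip s' (w s')], and then
    [0 <= ip (v - s') (w (v - s'))] reads [ip s' (w s') <= ip v (w v)]. *)
Lemma bessel_weighted M K u v ua ub : sobolev_pair a b u v ua ub -> (M <= K)%N ->
  M%:R ^+ 2 * nsq a b (horner (cell_proj K u - cell_proj M u)) <= h ^+ 2 * nsq a b v.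
Proof.
move=> [Iu Iv ibp _] MK; pose c i := (2 * i%:R + 1) / h * ip a b u (horner (Q i)).
pose s := \sum_(M <= i < K) c i *: Q i.
have -> : cell_proj K u - cell_proj M u = s by rewrite cell_projB.
(* T is the common value of ip v (w s') and ip s' (w s'). *)
pose T := \sum_(M <= i < K) i%:R * i.+1%:R * (c i * ip a b u (horner (Q i))).
have uQ i : ip a b u (horner (Q i)) = c i * ipp (Q i) (Q i).
  by rewrite nsq_cell_legendre /c; field; rewrite odd0 h0.
have Ls : deriv (w * deriv s) = \sum_(M <= i < K) - (i%:R * i.+1%:R * c i) *: Q i.
  rewrite /s raddf_sum /= mulr_sumr raddf_sum /=; apply: eq_bigr => i _.
  rewrite derivZ -scalerAr derivZ cell_legendre_ode// scalerA; congr (_ *: _); ring.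
have uL : ip a b u (horner (deriv (w * deriv s))) = - T.
  rewrite Ls ip_horner_sum// /T -sumrN; apply: eq_bigr => i _.
  by rewrite ip_hornerZ//; ring.
have sL : ipp s (deriv (w * deriv s)) = - T.
  rewrite Ls ip_horner_sum; last exact: inL2p.
  rewrite /T -sumrN big_nat [RHS]big_nat; apply: eq_bigr => i iM.
  rewrite ip_hornerZ; last exact: inL2p.
  by rewrite ipp_cell_sum iM uQ; ring.
have ws x : (w * deriv s).[x] = w.[x] * (deriv s).[x] by exact: hornerM.
have vT : ip a b v (horner (w * deriv s)) = T.
  have := ibp (w * deriv s).
  by rewrite uL !ws cell_weight_left cell_weight_right !mul0r !mulr0 subr0; lra.
have sT : ipp (deriv s) (w * deriv s) = T.
  have := ipp_ibp ab s (w * deriv s).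
  by rewrite sL !ws cell_weight_left cell_weight_right !mul0r !mulr0 subr0; lra.
have Iw f : inL2 a b f -> inL2 a b (horner w * f).
  move=> If; apply: inL2_mul_continuous => //; exact: horner_continuous.
have wx x : a < x < b -> 0 <= w.[x] <= h ^+ 2.
  move=> /andP[ax xb]; have -> : w.[x] = (x - a) * (b - x) by rewrite !hornerE.
  by apply/andP; split; nra.
have Tv : T <= h ^+ 2 * nsq a b v.
  have Ids := inL2p (deriv s).
  have : 0 <= ip a b (v - horner (deriv s)) (horner w * (v - horner (deriv s))).
    apply: Rintegral_ge0 => x /=; rewrite in_itv /= => /wx /andP[wx0 _].
    by rewrite fctM /= mulrCA mulr_ge0// -expr2 sqr_ge0.
  have wE f : ip a b f (horner w * (v - horner (deriv s))) =
      ip a b f (horner w * v - horner (w * deriv s)) by rewrite hornerMf mulrBr.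
  have Iwds := inL2p (w * deriv s).
  rewrite wE ipBl// ?ipBr//; try (by apply: inL2B => //; exact: Iw); try exact: Iw.
  have -> : ip a b (horner (deriv s)) (horner w * v) = T.
    by rewrite -ipMA ipC mulrC -hornerMf.
  rewrite vT sT => H; apply: (@le_trans _ _ (ip a b v (horner w * v))); first by lra.
  rewrite /nsq -ipZr// /ip; apply: le_Rintegral => //.
  - by apply: inL2_mul_integrable => //; exact: Iw.
  - by apply: inL2_mul_integrable => //; exact: inL2Z.
  move=> x /=; rewrite in_itv /= => /wx /andP[_ wxh].
  rewrite [v x * _]mulrCA [X in _ <= X]mulrCA ler_wpM2r// -expr2 sqr_ge0//.
apply: le_trans Tv.
rewrite /nsq {2}/s ip_horner_sum; last exact: inL2p.
rewrite mulr_sumr; apply: ler_sum_nat => i iM.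
rewrite ip_hornerZ; last exact: inL2p.
rewrite ipp_cell_sum iM uQ.
have -> : M%:R ^+ 2 * (c i * (c i * ipp (Q i) (Q i))) = M%:R ^+ 2 * (c i ^+ 2 * ipp (Q i) (Q i)) by ring.
have -> : c i * (c i * ipp (Q i) (Q i)) = c i ^+ 2 * ipp (Q i) (Q i) by ring.
rewrite ler_wpM2r//; first by rewrite mulr_ge0 ?sqr_ge0 ?nsq_ge0.
rewrite expr2 ler_pM ?ler0n// ler_nat; case/andP: iM => Mi _ //.
exact: leq_trans (leqnSn _).
Qed.

(** Let [K] tend to infinity in [bessel_weighted]; the density of polynomials
    makes the error at rank [K] as small as desired. *)
Lemma cell_proj_poincare M u v ua ub : sobolev_pair a b u v ua ub ->
  M%:R ^+ 2 * nsq a b (u - horner (cell_proj M u)) <= h ^+ 2 * nsq a b v.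
Proof.
move=> uv; have [Iu _ _ dense] := uv.
apply/ler_addgt0Pr => e e0.
have M0 : 0 <= M%:R ^+ 2 :> R by rewrite exprn_ge0.
have [p pe] := dense (e / (M%:R ^+ 2 + 1)) (divr_gt0 e0 (ltr_wpDl M0 ltr01)).
pose K := maxn M (size p).
have MK : (M <= K)%N by exact: leq_maxl.
have Kp : nsq a b (u - horner (cell_proj K u)) <= e / (M%:R ^+ 2 + 1).
  by apply: le_trans pe; apply: cell_proj_best => //; exact: leq_maxr.
have sM : (size (cell_proj M u) <= K)%N by exact: leq_trans (size_cell_proj M u) MK.
rewrite (cell_proj_pythagoras Iu sM) mulrDr addrC lerD//; first exact: bessel_weighted uv MK.
apply: le_trans (ler_wpM2l M0 Kp) _; rewrite mulrCA ger_pMr// ler_pdivrMr ?ltr_wpDl//.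
by rewrite mul1r lerDl.
Qed.

Lemma poly_antiderivative p : exists2 q, deriv q = p & (size q <= (size p).+1)%N.
Proof.
exists (\poly_(i < (size p).+1) (p`_i.-1 / i%:R)); last exact: size_poly.
apply/polyP => i; rewrite coef_deriv coef_poly ltnS.
case: ltnP => [ip|pi]; last by rewrite mul0rn nth_default.
by rewrite -[LHS]mulr_natr divfK// pnatr_eq0.
Qed.

(** Subtract from [u] a primitive of the projection of [v], which is a
    polynomial of degree at most [M]. *)
Lemma jackson_step M u v ua ub : sobolev_pair a b u v ua ub ->
  M.+1%:R ^+ 2 * nsq a b (u - horner (cell_proj M.+1 u)) <=
  h ^+ 2 * nsq a b (v - horner (cell_proj M v)).
Proof.
move=> uv; have [q dq sq] := poly_antiderivative (cell_proj M v).
have uqv := pairB uv (poly_pair q ab); rewrite dq in uqv.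
have H := cell_proj_poincare M.+1 uqv; apply: le_trans H.
apply: ler_wpM2l; first by rewrite exprn_ge0// ler0n.
rewrite -addrA -opprD -hornerDf; apply: cell_proj_best; first by case: uv.
apply: leq_trans (size_polyD _ _) _; rewrite geq_max size_cell_proj andbT.
by apply: leq_trans sq _; rewrite ltnS size_cell_proj.
Qed.

Lemma nsq_cell_legendre_pm N (s : R) : s ^+ 2 = 1 ->
  nsq a b (horner (Q N + s *: Q N.+1)) <= 2 * (h / (2 * N%:R + 1)).
Proof.
move=> s1; rewrite hornerDf hornerZf nsqDE; [|exact: inL2p|apply: inL2Z; exact: inL2p].
rewrite ipZr ?nsqZ; try exact: inL2p.
rewrite cell_legendre_ortho//; last by rewrite -[N in N != _]addn0 -addn1 eqn_add2l.
rewrite s1 mul1r !mulr0 addr0 /nsq !nsq_cell_legendre.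
rewrite [leRHS]mulrDl mul1r lerD2l.
rewrite ler_pM2l// lef_pV2 ?posrE; last 2 first.
- by rewrite ltr_wpDl ?mulr_ge0.
- by rewrite ltr_wpDl ?mulr_ge0.
by rewrite lerD2r ler_pM2l// ler_nat.
Qed.

(** The polynomial [Q N + Q N.+1] vanishes at [a] and [Q N - Q N.+1] vanishes at
    [b], so that testing the derivative of the error against them isolates one
    boundary value of the error. Both are orthogonal to the polynomials of
    degree less than [N], hence only the error of [v] contributes, and their
    norms provide the factor [N ^ (-1/2)]. *)
Lemma trace_bound N u v ua ub : sobolev_pair a b u v ua ub ->
  (ua - (cell_proj N.+1 u).[a]) ^+ 2 + (ub - (cell_proj N.+1 u).[b]) ^+ 2 <=
  h / (2 * N%:R + 1) * nsq a b (v - horner (cell_proj N v)).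
Proof.
set p := cell_proj N.+1 u => uv; have [Iu Iv _ _] := uv.
set ea := ua - _; set eb := ub - _; set E := nsq _ _ _.
have [Ie Ie' ibp _] := pairB uv (poly_pair p ab); rewrite -/ea -/eb in ibp.
have sp : (size p <= N.+1)%N by exact: size_cell_proj.
(* The two test polynomials are the cases s = 1 and s = -1. *)
have key (s : R) : s ^+ 2 = 1 ->
    (eb * (1 + s) - ea * ((-1) ^+ N * (1 - s))) ^+ 2 <= E * (2 * (h / (2 * N%:R + 1))).
  move=> s1; pose q := Q N + s *: Q N.+1.
  have sq : (size q <= N.+2)%N.
    apply: leq_trans (size_polyD _ _) _; rewrite geq_max size_cell_legendre// leqnSn /=.
    by apply: leq_trans (size_scale_leq _ _) _; rewrite size_cell_legendre.
  have qlow (f : {poly R}) : (size f <= N)%N -> ipp f q = 0.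
    move=> sf; rewrite ipC /q hornerDf hornerZf ipDl ?ipZl; try exact: inL2p.
      by rewrite !cell_legendre_low ?mulr0 ?addr0// ltnW.
    by apply: inL2Z; exact: inL2p.
  have := ibp q; rewrite cell_proj_ortho//; last first.
    have [->|q0] := eqVneq q 0; first by rewrite deriv0 size_poly0.
    by rewrite -ltnS; apply: leq_trans (lt_size_deriv q0) sq.
  have -> : q.[b] = 1 + s by rewrite hornerD hornerZ !cell_legendre_right// mulr1.
  have -> : q.[a] = (-1) ^+ N * (1 - s).
    by rewrite hornerD hornerZ !cell_legendre_left// exprS; ring.
  rewrite addr0 => <-.
  have -> : ip a b (v - horner (deriv p)) (horner q) =
      ip a b (v - horner (cell_proj N v)) (horner q).
    rewrite !ipBl//; try exact: inL2p.
    rewrite !qlow ?size_cell_proj// -ltnS.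
    have [->|p0] := eqVneq p 0; first by rewrite deriv0 size_poly0.
    exact: leq_trans (lt_size_deriv p0) sp.
  apply: le_trans (cauchy_schwarz _ _) _; [apply: inL2B => //; exact: inL2p|exact: inL2p|].
  by rewrite ler_wpM2l ?nsq_ge0// nsq_cell_legendre_pm.
have := key (-1); rewrite sqrrN expr1n => /(_ erefl).
have := key 1 (expr1n _ _).
rewrite !(subrr, addrN, mulr0, subr0, sub0r, opprK) sqrrN !exprMn sqrr_sign mul1r.
by move=> ? ?; lra.
Qed.

Lemma sum_odd M : \sum_(0 <= i < M) (2 * i%:R + 1) = M%:R ^+ 2 :> R.
Proof.
elim: M => [|M IH]; first by rewrite big_nil expr0n.
by rewrite big_nat_recr //= IH -natr1; ring.
Qed.

(** Cauchy-Schwarz with the reproducing kernel [k] of the evaluation at [x]: the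
    square of its norm is [k.[x]], the sum of the first [M] odd numbers
    over [b - a]. *)
Lemma poly_eval_bound M p x : (forall i, (Q i).[x] ^+ 2 = 1) -> (size p <= M)%N ->
  p.[x] ^+ 2 <= M%:R ^+ 2 / h * nsq a b (horner p).
Proof.
move=> Qx sp.
pose k := \sum_(0 <= i < M) ((2 * i%:R + 1) / h * (Q i).[x]) *: Q i.
have rep q : (size q <= M)%N -> ipp k q = q.[x].
  move=> /(cell_legendre_span ab)[c ->].
  rewrite ip_horner_sum; last exact: inL2p.
  rewrite horner_sum big_nat [RHS]big_nat; apply: eq_bigr => i iM.
  rewrite ip_hornerZ; last exact: inL2p.
  rewrite ipp_cell_sum iM nsq_cell_legendre hornerZ; field; rewrite odd0; exact: h0.
have sk : (size k <= M)%N by exact: size_cell_sum.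
have kk : nsq a b (horner k) = M%:R ^+ 2 / h.
  rewrite /nsq rep// /k horner_sum -sum_odd mulr_suml; apply: eq_bigr => i _.
  rewrite hornerZ; transitivity ((2 * i%:R + 1) / h * (Q i).[x] ^+ 2); first by ring.
  by rewrite Qx mulr1.
rewrite -kk -(rep _ sp); apply: cauchy_schwarz; exact: inL2p.
Qed.

Lemma poly_trace_bound M p : (size p <= M)%N ->
  p.[a] ^+ 2 <= M%:R ^+ 2 / h * nsq a b (horner p) /\
  p.[b] ^+ 2 <= M%:R ^+ 2 / h * nsq a b (horner p).
Proof.
move=> sp; split; apply: poly_eval_bound sp => i.
  by rewrite cell_legendre_left// sqrr_sign.
by rewrite cell_legendre_right// expr1n.
Qed.

(** Let [e] be the error of [u] and [d] the polynomial to be bounded. The error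
    of [v] is orthogonal to [d], so that [nsq d = ip e' d], where integration
    by parts leaves only boundary terms since [e] is orthogonal to [d'].
    Bound [e] at the boundary by [trace_bound] and [d] by [poly_trace_bound]. *)
Lemma cell_proj_derive_defect N u v ua ub : sobolev_pair a b u v ua ub ->
  nsq a b (horner (cell_proj N.+1 v - deriv (cell_proj N.+1 u))) <=
  2 * N.+1%:R * nsq a b (v - horner (cell_proj N v)).
Proof.
set p := cell_proj N.+1 u => uv; have [Iu Iv _ _] := uv.
have T := trace_bound N uv; rewrite -/p in T.
have [Ie Ie' ibp _] := pairB uv (poly_pair p ab).
set ea := ua - _ in T ibp; set eb := ub - _ in T ibp; set E := nsq _ _ _ in T *.
set d := cell_proj N.+1 v - deriv p.
have sder q : (size q <= N.+1)%N -> (size (deriv q) <= N.+1)%N.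
  move=> sq; have [->|q0] := eqVneq q 0; first by rewrite deriv0 size_poly0.
  exact/ltnW/(leq_trans (lt_size_deriv q0) sq).
have sd : (size d <= N.+1)%N.
  apply: leq_trans (size_polyD _ _) _; rewrite size_polyN geq_max size_cell_proj /=.
  by apply: sder; exact: size_cell_proj.
have dE : nsq a b (horner d) = eb * d.[b] - ea * d.[a].
  have := ibp d; rewrite cell_proj_ortho ?addr0//; last exact: sder.
  move=> <-; rewrite (_ : v - _ = (v - horner (cell_proj N.+1 v)) + horner d); last first.
    by rewrite /d hornerBf addrA subrK.
  rewrite ipDl; [|by apply: inL2B => //; exact: inL2p|exact: inL2p|exact: inL2p].
  by rewrite cell_proj_ortho// add0r.
have [da db] := poly_trace_bound sd.
set D := nsq a b (horner d) in dE da db *.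
have D0 : 0 <= D by exact: nsq_ge0.
have E0 : 0 <= E by exact: nsq_ge0.
have N0 : 0 < N.+1%:R :> R by rewrite ltr0n.
have [->|Dn0] := eqVneq D 0; first by rewrite !mulr_ge0// ltW.
have Dgt0 : 0 < D by rewrite lt_neqAle eq_sym Dn0.
(* The bounds on d at the boundary involve D itself, whence a quadratic
   inequality for D. *)
have D2 : D ^+ 2 <= 2 * (ea ^+ 2 + eb ^+ 2) * (N.+1%:R ^+ 2 / h * D).
  have S : D ^+ 2 <= 2 * (eb ^+ 2 * d.[b] ^+ 2 + ea ^+ 2 * d.[a] ^+ 2).
    by rewrite dE -!exprMn; have := sqr_ge0 (eb * d.[b] + ea * d.[a]); nra.
  apply: le_trans S _; rewrite -mulrA ler_pM2l// mulrDl addrC lerD//; by rewrite ler_wpM2l ?sqr_ge0.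
rewrite -(ler_pM2l Dgt0) -expr2; apply: (le_trans D2).
have K0 : 0 <= N.+1%:R ^+ 2 / h * D by rewrite mulr_ge0// divr_ge0 ?exprn_ge0// ltW.
apply: (@le_trans _ _ (2 * (h / (2 * N%:R + 1) * E) * (N.+1%:R ^+ 2 / h * D))).
  by rewrite ler_wpM2r// ler_pM2l.
have odd_gt0 : 0 < 2 * N%:R + 1 :> R by rewrite ltr_wpDl ?mulr_ge0.
have -> : 2 * (h / (2 * N%:R + 1) * E) * (N.+1%:R ^+ 2 / h * D) =
    D * (2 * N.+1%:R * E) * (N.+1%:R / (2 * N%:R + 1)).
  by field; rewrite odd0; exact: h0.
rewrite ler_piMr ?mulr_ge0 ?(ltW N0)// ler_pdivrMr// mul1r -natr1 lerD2r.
by rewrite ler_peMl// ler1n.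
Qed.


End Projection.

(** * The inverse inequality *)

Section InverseInequality.
Context {R : realType}.
Variables (a b : R) (ab : a < b).
Implicit Types (c x : R) (u v : R -> R) (p q : {poly R}) (i j n M : nat).
Local Notation Q := (cell_legendre a b).
Local Notation w := (cell_weight a b).
Local Notation h := (b - a).
Local Notation ipp p q := (ip a b (horner p) (horner q)).
Local Notation inL2p := (inL2_horner a b).

Let h0 : h != 0. Proof. by rewrite subr_eq0 gt_eqF. Qed.
Let hgt0 : 0 < h. Proof. by rewrite subr_gt0. Qed.

Lemma deriv_cell_weight x : (deriv w).[x] = a + b - 2 * x.
Proof. by rewrite derivM derivB derivX derivC derivB derivX derivC !hornerE; ring. Qed.

Lemma deriv_cell_legendre_right n : h * (deriv (Q n)).[b] = n%:R * n.+1%:R.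
Proof.
have := congr1 (fun p => p.[b]) (cell_legendre_ode n ab).
have E1 := hornerM (deriv w) (deriv (Q n)) b.
have E2 := hornerM w (deriv (deriv (Q n))) b.
rewrite derivM hornerD E1 E2 hornerZ cell_weight_right mul0r addr0.
by rewrite deriv_cell_weight cell_legendre_right// mulr1 => H; lra.
Qed.

Lemma deriv_cell_legendre_left n : h * (deriv (Q n)).[a] = - (n%:R * n.+1%:R) * (-1) ^+ n.
Proof.
have := congr1 (fun p => p.[a]) (cell_legendre_ode n ab).
have E1 := hornerM (deriv w) (deriv (Q n)) a.
have E2 := hornerM w (deriv (deriv (Q n))) a.
rewrite derivM hornerD E1 E2 hornerZ cell_weight_left mul0r addr0.
by rewrite deriv_cell_weight cell_legendre_left// => H; lra.
Qed.

Lemma nsq_deriv_cell_legendre n :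
  nsq a b (horner (deriv (Q n))) = 2 * (n%:R * n.+1%:R) / h.
Proof.
have low : ipp (Q n) (deriv (deriv (Q n))) = 0.
  apply: cell_legendre_low => //; have [->|q0] := eqVneq (deriv (Q n)) 0.
    by rewrite deriv0 size_poly0.
  apply: leq_trans (_ : size (deriv (Q n)) <= n)%N; first exact/ltnW/lt_size_deriv.
  have /lt_size_deriv : Q n != 0 by apply: contraNneq q0 => ->; rewrite deriv0.
  by rewrite size_cell_legendre.
have := ipp_ibp ab (Q n) (deriv (Q n)).
rewrite low addr0 cell_legendre_right// cell_legendre_left// /nsq => ->.
apply: (mulfI h0); rewrite mulrBr mul1r mulrCA deriv_cell_legendre_left.
rewrite deriv_cell_legendre_right mulrCA -expr2 sqrr_sign; field; exact: h0.
Qed.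

(** A Cauchy-Schwarz inequality with weights [g i]. *)
Lemma nsq_sum_le M (c g : nat -> R) (F : nat -> {poly R}) : (forall i, 0 < g i) ->
  nsq a b (horner (\sum_(0 <= i < M) c i *: F i)) <=
  (\sum_(0 <= i < M) c i ^+ 2 * g i) * (\sum_(0 <= i < M) nsq a b (horner (F i)) / g i).
Proof.
move=> g0; elim: M => [|M IH].
  by rewrite !big_nil mul0r horner0f -(scale0r (cst 1)) nsqZ ?expr0n ?mul0r//; exact: inL2_cst.
rewrite !big_nat_recr //=; move: IH.
set A := \sum_(0 <= i < M) c i *: F i; set S := \sum_(0 <= i < M) c i ^+ 2 * g i.
set T := \sum_(0 <= i < M) nsq a b (horner (F i)) / g i => IH.
have S0 : 0 <= S by apply: sumr_ge0 => i _; rewrite mulr_ge0 ?sqr_ge0// ltW.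
have T0 : 0 <= T by apply: sumr_ge0 => i _; rewrite divr_ge0 ?nsq_ge0// ltW.
have [IA IF] := (inL2p A, inL2p (F M)).
rewrite hornerDf hornerZf nsqDE//; last exact: inL2Z.
rewrite ipZr// nsqZ//.
have CS := cauchy_schwarz IA IF.
set s := ip _ _ _ _ in CS *; set n := nsq _ _ (horner (F M)) in CS *.
have n0 : 0 <= n by exact: nsq_ge0.
have A0 := nsq_ge0 a b (horner A); set NA := nsq _ _ (horner A) in IH CS A0 *.
have gM := g0 M; set d := c M; set gg := g M in gM *.
have -> : (S + d ^+ 2 * gg) * (T + n / gg) =
    S * T + (S * (n / gg) + d ^+ 2 * gg * T) + d ^+ 2 * n.
  by field; rewrite gt_eqF.
apply: lerD => //; apply: lerD => //.
have X0 : 0 <= S * (n / gg) by rewrite mulr_ge0// divr_ge0// ltW.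
have Y0 : 0 <= d ^+ 2 * gg * T by rewrite mulr_ge0// mulr_ge0 ?sqr_ge0// ltW.
(* The cross term 2 d s is at most X + Y by the arithmetic-geometric mean,
   where X and Y are the two cross terms of the product of sums. *)
have XY : (d * s) ^+ 2 <= (S * (n / gg)) * (d ^+ 2 * gg * T).
  have -> : (S * (n / gg)) * (d ^+ 2 * gg * T) = d ^+ 2 * ((S * T) * n).
    by field; rewrite gt_eqF.
  rewrite exprMn ler_wpM2l ?sqr_ge0//; apply: (le_trans CS).
  by rewrite ler_wpM2r.
move: X0 Y0 XY; move: (S * _) (_ * T) (d * s) => X Y z X0 Y0 XY.
have [z0|/ltW z0] := leP z 0; first by apply: (@le_trans _ _ 0); [lra|rewrite addr_ge0].
rewrite -(ler_pXn2r (ltn0Sn 1)) ?nnegrE ?mulr_ge0 ?addr_ge0//.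
have := sqr_ge0 (X - Y); nra.
Qed.

(** On the Legendre basis, [nsq (Q i)' / nsq (Q i)] is of order [i ^ 3 / h ^ 2];
    add up over [i < M]. *)
Lemma inverse_inequality M p : (size p <= M)%N ->
  h ^+ 2 * nsq a b (horner (deriv p)) <= 4 * M%:R ^+ 4 * nsq a b (horner p).
Proof.
move=> /(cell_legendre_span ab)[c pE].
pose g i := nsq a b (horner (Q i)).
have odd_gt0 i : 0 < 2 * i%:R + 1 :> R by rewrite ltr_wpDl ?mulr_ge0.
have gE i : g i = h / (2 * i%:R + 1) by rewrite /g /nsq nsq_cell_legendre.
have g0 i : 0 < g i by rewrite gE divr_gt0.
have Np : nsq a b (horner p) = \sum_(0 <= i < M) c i ^+ 2 * g i.
  rewrite /nsq {2}pE ip_horner_sum; last exact: inL2p.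
  rewrite big_nat [RHS]big_nat; apply: eq_bigr => i iM.
  rewrite ip_hornerZ; last exact: inL2p.
  by rewrite pE ipp_cell_sum// iM /g /nsq; ring.
have dp : deriv p = \sum_(0 <= i < M) c i *: deriv (Q i).
  by rewrite pE raddf_sum /=; apply: eq_bigr => i _; rewrite derivZ.
have := nsq_sum_le M c (fun i => deriv (Q i)) g0; rewrite -dp -Np => H.
have Tle : h ^+ 2 * (\sum_(0 <= i < M) nsq a b (horner (deriv (Q i))) / g i) <= 4 * M%:R ^+ 4.
  rewrite mulr_sumr; apply: (@le_trans _ _ (\sum_(0 <= i < M) 4 * M%:R ^+ 3)).
    apply: ler_sum_nat => i /andP[_ iM]; rewrite nsq_deriv_cell_legendre gE.
    have -> : h ^+ 2 * (2 * (i%:R * i.+1%:R) / h / (h / (2 * i%:R + 1))) =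
        (2 * (i * i.+1 * (2 * i + 1)))%N%:R.
      rewrite !natrM natrD natrM; field; rewrite h0 /= gt_eqF//.
    rewrite -natrX -natrM ler_nat.
    have H3 : (i * i.+1 * (2 * i + 1) <= M * M * (2 * M))%N by rewrite !leq_mul//; lia.
    by rewrite !expnS expn0; nia.
  by rewrite sumr_const_nat subn0 -[leLHS]mulr_natr [M%:R ^+ 4]exprSr mulrA.
apply: le_trans (ler_wpM2l (sqr_ge0 h) H) _.
by rewrite mulrCA mulrC ler_wpM2r ?nsq_ge0.
Qed.

Lemma inverse_inequality_iter r M p : (size p <= M)%N ->
  h ^+ (2 * r) * nsq a b (horner (derivn r p)) <= (4 * M%:R ^+ 4) ^+ r * nsq a b (horner p).
Proof.
elim: r p => [|r IH] p sp; first by rewrite muln0 !expr0 !mul1r.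
rewrite derivSn; have sdp : (size (deriv p) <= M)%N.
  have [->|p0] := eqVneq p 0; first by rewrite deriv0 size_poly0.
  exact/ltnW/(leq_trans (lt_size_deriv p0) sp).
rewrite mulnS exprD -mulrA.
apply: le_trans (ler_wpM2l (sqr_ge0 h) (IH _ sdp)) _.
rewrite mulrCA [_ ^+ r.+1]exprSr -[leRHS]mulrA; apply: ler_wpM2l.
  by rewrite exprn_ge0// mulr_ge0// exprn_ge0.
exact: inverse_inequality.
Qed.

End InverseInequality.

(** * Estimates of higher order on a cell *)

Section MainEstimate.
Context {R : realType}.
Implicit Types (a b c x : R) (U : nat -> R -> R) (p q : {poly R}) (i j n M m r : nat).

(** [U j] stands for the weak derivative of order [j] of [U 0]. *)
Definition sobolev_chain a b m U := (forall j, (j <= m)%N -> inL2 a b (U j)) /\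
  forall j, (j < m)%N -> exists ua ub, sobolev_pair a b (U j) (U j.+1) ua ub.

Lemma sobolev_chainS a b m U : sobolev_chain a b m.+1 U ->
  sobolev_chain a b m (fun j => U j.+1).
Proof. by move=> [H1 H2]; split=> j jm; [exact: H1|exact: H2]. Qed.

Lemma exprS_natr_le m M : (0 < M)%N ->
  M.+1%:R ^+ (2 * m) <= 4 ^+ m * M%:R ^+ (2 * m) :> R.
Proof.
move=> M0; rewrite !exprM -exprMn lerXn2r ?nnegrE ?exprn_ge0 ?mulr_ge0 ?exprn_ge0//.
rewrite -!natrX -natrM ler_nat; nia.
Qed.

(** The shift of the rank from [M.+1] to [M] at each step is paid by a power
    of 4. *)
Lemma jackson a b m M U : a < b -> sobolev_chain a b m U -> (m <= M)%N ->
  M%:R ^+ (2 * m) * nsq a b (U 0 - horner (cell_proj a b M (U 0))) <=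
  4 ^+ (m ^ 2) * (b - a) ^+ (2 * m) * nsq a b (U m).
Proof.
move=> ab; elim: m M U => [|m IH] M U ch mM.
  have U0 : inL2 a b (U 0) by apply: ch.1.
  rewrite muln0 !expr0 !mul1r; have := @cell_proj_best _ _ _ ab M (U 0) 0 U0.
  by rewrite size_poly0 horner0f subr0; apply.
case: M mM => // M mM; have [ua [ub uv]] := ch.2 0 isT.
have J := jackson_step ab M uv; have {IH} := IH M _ (sobolev_chainS ch) mM.
set E1 := nsq _ _ _ in J *; set E := nsq _ _ (U 1 - _) in J *; set N := nsq _ _ (U m.+1) => I.
have E0 : 0 <= E by exact: nsq_ge0.
have MM : M.+1%:R ^+ (2 * m) <= 4 ^+ m * M%:R ^+ (2 * m) :> R.
  case: (posnP m) => [->|m0]; first by rewrite muln0 !expr0 mul1r.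
  by apply: exprS_natr_le; exact: leq_trans m0 mM.
rewrite mulnS exprD [M.+1%:R ^+ 2 * _]mulrC -[leLHS]mulrA.
apply: le_trans (ler_wpM2l (exprn_ge0 _ (ler0n _ _)) J) _.
rewrite mulrCA; apply: (@le_trans _ _ ((b - a) ^+ 2 * (4 ^+ m * (4 ^+ (m ^ 2) * (b - a) ^+ (2 * m) * N)))).
  rewrite ler_wpM2l ?sqr_ge0//; apply: (@le_trans _ _ (4 ^+ m * M%:R ^+ (2 * m) * E)).
    by rewrite ler_wpM2r.
  by rewrite -mulrA ler_wpM2l ?exprn_ge0.
have -> : (b - a) ^+ 2 * (4 ^+ m * (4 ^+ (m ^ 2) * (b - a) ^+ (2 * m) * N)) =
    4 ^+ (m + m ^ 2) * ((b - a) ^+ (2 + 2 * m) * N) by rewrite !exprD; ring.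
rewrite mulrA ler_wpM2r ?nsq_ge0// ler_wpM2r ?exprn_ge0 ?subr_ge0 ?(ltW ab)//.
by rewrite ler_weXn2l ?ler1n//; nia.
Qed.

(** The bookkeeping in the induction of [sobolev_error]. Here [X] is the error of
    order [r] of [U 1], [D] and [Y] are the squared norms of the defect and of
    its derivative of order [r], and [E] is the error of [U 1] at the previous
    rank [n]. *)
Lemma defect_bounds r m (h M n C1 X Y D E V : R) : (r <= m)%N -> 0 < h -> 1 <= M ->
  0 <= n -> 0 <= C1 -> 0 <= E -> 0 <= V ->
  M ^+ (2 * m).+1 * X <= C1 * h ^+ (2 * (m - r)) * M ^+ (4 * r).+1 * V ->
  h ^+ (2 * r) * Y <= (4 * M ^+ 4) ^+ r * D ->
  D <= 2 * M * E ->
  n ^+ (2 * m) * E <= 4 ^+ (m ^ 2) * h ^+ (2 * m) * V ->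
  M ^+ (2 * m) <= 4 ^+ m * n ^+ (2 * m) ->
  M ^+ (2 * m.+1).+1 * (2 * X + 2 * Y) <=
  (2 * C1 + 2 * (4 ^+ (r + m + m ^ 2) * 2)) * h ^+ (2 * (m - r)) * M ^+ (4 * r.+1) * V.
Proof.
move=> rm hgt0 M1 n0 C10 E0 V0 I1 I2 I3 I4 I5.
have e1 : ((2 * m.+1).+1 = 2 + (2 * m).+1)%N by rewrite mulnS addnS.
have e2 : (2 + (4 * r).+1 <= 4 * r.+1)%N by rewrite mulnS addnS -addSn leq_add2r.
have e3 : ((2 * m.+1).+1 = 2 * m + 3)%N by rewrite mulnS addnC -addnS.
have e4 : (4 * r.+1 = 4 * r + 4)%N by rewrite mulnS addnC.
have e5 : (2 * m = 2 * r + 2 * (m - r))%N by rewrite -mulnDr subnKC.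
have M0 : 0 <= M by exact: le_trans M1.
have h0 := ltW hgt0.
have PX : M ^+ (2 * m.+1).+1 * X <= C1 * h ^+ (2 * (m - r)) * M ^+ (4 * r.+1) * V.
  rewrite e1.
  rewrite exprD -mulrA; apply: le_trans (ler_wpM2l (exprn_ge0 _ M0) I1) _.
  rewrite mulrA ler_wpM2r// mulrCA ler_wpM2l ?mulr_ge0 ?exprn_ge0//.
  by rewrite -exprD ler_weXn2l.
have PY : M ^+ (2 * m.+1).+1 * Y <= 4 ^+ (r + m + m ^ 2) * 2 * h ^+ (2 * (m - r)) * M ^+ (4 * r.+1) * V.
  rewrite -(ler_pM2l (exprn_gt0 (2 * r) hgt0)) mulrCA.
  apply: le_trans (ler_wpM2l (exprn_ge0 _ M0) I2) _.
  apply: (@le_trans _ _ (M ^+ (2 * m.+1).+1 * ((4 * M ^+ 4) ^+ r * (2 * M * E)))).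
    by rewrite !ler_wpM2l ?exprn_ge0 ?mulr_ge0 ?exprn_ge0.
  apply: (@le_trans _ _ (4 ^+ r * 2 * M ^+ (4 * r.+1) * (4 ^+ m * (4 ^+ (m ^ 2) * h ^+ (2 * m) * V)))).
    have -> : M ^+ (2 * m.+1).+1 * ((4 * M ^+ 4) ^+ r * (2 * M * E)) =
        4 ^+ r * 2 * M ^+ (4 * r.+1) * (M ^+ (2 * m) * E).
      by rewrite e3 e4 exprMn -exprM !exprD; ring.
    rewrite ler_wpM2l ?mulr_ge0 ?exprn_ge0//.
    apply: (@le_trans _ _ (4 ^+ m * n ^+ (2 * m) * E)); first by rewrite ler_wpM2r.
    by rewrite -mulrA ler_wpM2l ?exprn_ge0.
  rewrite le_eqVlt; apply/orP; left; apply/eqP.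
  by rewrite e5 !exprD; ring.
move: PX PY; move: (M ^+ _.+1) (h ^+ _) (M ^+ (4 * _)) (4 ^+ _ * 2) => A B F G PX PY.
have -> : A * (2 * X + 2 * Y) = 2 * (A * X) + 2 * (A * Y) by ring.
have -> : (2 * C1 + 2 * G) * B * F * V = 2 * (C1 * B * F * V) + 2 * (G * B * F * V) by ring.
by rewrite lerD// ler_pM2l.
Qed.

(** The derivative of the projection of [U 0] is the projection of [U 1] up to a
    defect. The former is handled by induction on [r], the latter by the
    inverse inequality. The exponents [4 * r] and [(2 * m).+1] are the square of
    [M ^ (2 r - 1/2 - m)], freed from negative powers. *)
Lemma sobolev_error r m : exists2 C : R, 0 <= C &
  forall a b M U, a < b -> sobolev_chain a b m U -> (1 <= r <= m)%N -> (m <= M)%N -> (2 <= M)%N ->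
  M%:R ^+ (2 * m).+1 * nsq a b (U r - horner (derivn r (cell_proj a b M (U 0)))) <=
  C * (b - a) ^+ (2 * (m - r)) * M%:R ^+ (4 * r) * nsq a b (U m).
Proof.
elim: r m => [|r IH] m; first by exists 0 => // a b M U _ _ /andP[].
case: m => [|m]; first by exists 0 => // a b M U _ _ /andP[].
have [C1 C10 HC1] : exists2 C : R, 0 <= C &
  forall a b M U, a < b -> sobolev_chain a b m U -> (r <= m)%N -> (m <= M)%N -> (2 <= M)%N ->
    M%:R ^+ (2 * m).+1 * nsq a b (U r - horner (derivn r (cell_proj a b M (U 0)))) <=
    C * (b - a) ^+ (2 * (m - r)) * M%:R ^+ (4 * r).+1 * nsq a b (U m).
  case: r IH => [|r] IH.
    exists (4 ^+ (m ^ 2)) => // a b M U ab ch _ mM _.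
    have := jackson ab ch mM; rewrite subn0 muln0 expr1 => H.
    rewrite exprS -mulrA; apply: le_trans (ler_wpM2l (ler0n _ _) H) _.
    by rewrite mulrC mulrAC.
  have [C C0 HC] := IH m; exists C => // a b M U ab ch rm mM M2.
  apply: le_trans (HC a b M U ab ch rm mM M2) _.
  rewrite ler_wpM2r ?nsq_ge0// ler_wpM2l ?mulr_ge0 ?exprn_ge0 ?subr_ge0 ?(ltW ab)//.
  by rewrite ler_weXn2l// ler1n; lia.
pose C2 : R := 4 ^+ (r + m + m ^ 2) * 2.
exists (2 * C1 + 2 * C2); first by rewrite addr_ge0 ?mulr_ge0// exprn_ge0.
move=> a b M U ab ch /andP[_ rm] mM M2; rewrite ltnS in rm.
have mM' : (m <= M)%N by exact: ltnW.
have chS := sobolev_chainS ch; have [ua [ub uv]] := ch.2 0 isT.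
case: M mM mM' M2 => // N mM mM' M2; rewrite ltnS in mM.
pose d := cell_proj a b N.+1 (U 1) - deriv (cell_proj a b N.+1 (U 0)).
have h0 : 0 <= b - a by rewrite subr_ge0 ltW.
have Ur : inL2 a b (U r.+1) by exact: ch.1.
have split_err : U r.+1 - horner (derivn r.+1 (cell_proj a b N.+1 (U 0))) =
    (U r.+1 - horner (derivn r (cell_proj a b N.+1 (U 1)))) + horner (derivn r d).
  by rewrite derivSn /d linearB /= hornerBf addrA subrK.
have I1 := HC1 a b N.+1 _ ab chS rm mM' M2.
have sd : (size d <= N.+1)%N.
  apply: leq_trans (size_polyD _ _) _; rewrite size_polyN geq_max size_cell_proj//=.
  have sp := size_cell_proj ab N.+1 (U 0).
  have [->|p0] := eqVneq (cell_proj a b N.+1 (U 0)) 0; first by rewrite deriv0 size_poly0.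
  exact/ltnW/(leq_trans (lt_size_deriv p0) sp).
have I2 := inverse_inequality_iter ab r sd.
have I3 := cell_proj_derive_defect ab N uv; rewrite -/d in I3.
have I4 := jackson ab chS mM.
have V0 := nsq_ge0 a b (U m.+1).
have E0 := nsq_ge0 a b (U 1 - horner (cell_proj a b N (U 1))).
have I5 := exprS_natr_le m (M2 : (0 < N)%N).
have IX : inL2 a b (U r.+1 - horner (derivn r (cell_proj a b N.+1 (U 1)))).
  by apply: inL2B => //; exact: inL2_horner.
rewrite split_err; have S := nsqD_le IX (inL2_horner a b (derivn r d)).
have Mge1 : 1 <= N.+1%:R :> R by rewrite ler1n.
have hgt0 : 0 < b - a by rewrite subr_gt0.
have := defect_bounds rm hgt0 Mge1 (ler0n R N) C10 E0 V0 I1 I2 I3 I4 I5.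
rewrite subSS; apply: le_trans; rewrite ler_wpM2l// exprn_ge0//; exact: le_trans Mge1.
Qed.

End MainEstimate.

(** * Weak derivatives and subdivision of the interval *)

Section WeakCalculus.
Context {R : realType}.
Implicit Types (a b c x : R) (f g u v phi : R -> R) (p q : {poly R}) (i j n m : nat).
Local Notation mu := (@lebesgue_measure R).

Lemma test_function_derive1n a b j phi : test_function a b phi ->
  test_function a b (derive1n j phi).
Proof. by move=> t; elim: j => //= j IH; exact: test_function_derive1. Qed.

Lemma test_function_sub a b a' b' phi : a <= a' -> b' <= b ->
  test_function a' b' phi -> test_function a b phi.
Proof.
move=> aa' bb' [dphi [c [e [ac eb H]]]]; split => //; exists c, e; split => //.
  exact: le_lt_trans ac.
exact: lt_le_trans bb'.
Qed.

Lemma test_function_out a b phi x : test_function a b phi -> x \notin `]a, b[ -> phi x = 0.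
Proof.
move=> [_ [c [e [ac eb H]]]] xab; apply: H; move: xab.
by rewrite !in_itv /= !negb_and -!leNgt -!ltNge => /orP[]?; apply/orP; [left|right]; lra.
Qed.

Lemma int_sub a b a' b' f : a <= a' -> b' <= b ->
  (forall x, x \notin `]a', b'[ -> f x = 0) ->
  \int[mu]_(x in `]a, b[) f x = \int[mu]_(x in `]a', b'[) f x.
Proof.
move=> aa' bb' f0; rewrite Rintegral_mkcond [RHS]Rintegral_mkcond.
apply: eq_Rintegral => x _; rewrite !patchE !mem_setE.
case: (boolP (x \in `]a', b'[)) => [xab|/f0 ->]; last by case: ifP.
suff -> : x \in `]a, b[ by [].
by move: xab; rewrite !in_itv /=; lra.
Qed.

Lemma weak_derivative_sub a b a' b' j f g : a <= a' -> b' <= b ->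
  weak_derivative a b j f g -> weak_derivative a' b' j f g.
Proof.
move=> aa' bb' wd phi tphi; have := wd _ (test_function_sub aa' bb' tphi).
have tj := test_function_derive1n j tphi.
rewrite (int_sub aa' bb') => [->|x xab]; last by rewrite (test_function_out tj xab) mulr0.
congr (_ * _); rewrite (int_sub aa' bb')// => x xab.
by rewrite (test_function_out tphi xab) mulr0.
Qed.

Lemma weak_derivative_unique a b j f g g' : inL2 a b g -> inL2 a b g' ->
  weak_derivative a b j f g -> weak_derivative a b j f g' -> nsq a b (g - g') = 0.
Proof.
move=> Ig Ig' wg wg'; apply: fundamental_lemma => [|phi tphi]; first exact: inL2B.
rewrite ipBl//; last exact: test_inL2 tphi.
apply/eqP; rewrite subr_eq0; apply/eqP.
by apply: (@mulfI _ ((-1) ^+ j)); [rewrite signr_eq0|rewrite -wg// -wg'].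
Qed.

Lemma weak_derivative_quotient a b j f g g' :
  weak_derivative a b j f g -> weak_derivative a b j.+1 f g' ->
  weak_derivative a b 1 g g'.
Proof.
move=> wg wg' phi tphi; have := wg _ (test_function_derive1 tphi).
have := wg' _ tphi; rewrite {1}/derive1n iterSr => -> H.
apply: (@mulfI _ ((-1) ^+ j)); first by rewrite signr_eq0.
by rewrite -[LHS]H exprSr expr1 mulrA.
Qed.

Lemma weak_derivative_comp a b j f g g' :
  weak_derivative a b j f g -> weak_derivative a b 1 g g' ->
  weak_derivative a b j.+1 f g'.
Proof.
move=> wg wg' phi tphi; have := wg _ (test_function_derive1 tphi).
rewrite -{1}[derive1n j _]/(iter j _ _) -iterSr => ->.
by rewrite [X in _ * X](wg' _ tphi) expr1 mulrA exprSr.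
Qed.

Lemma weak_derivative0 a b f : weak_derivative a b 0 f f.
Proof. by move=> phi _; rewrite expr0 mul1r. Qed.

Lemma weak_derivativeB a b j f g f' g' : inL2 a b f -> inL2 a b f' ->
  inL2 a b g -> inL2 a b g' ->
  weak_derivative a b j f g -> weak_derivative a b j f' g' ->
  weak_derivative a b j (f - f') (g - g').
Proof.
move=> If If' Ig Ig' wg wg' phi tphi.
have Ip := test_inL2 a b tphi; have Ij := test_inL2 a b (test_function_derive1n j tphi).
rewrite -[LHS]/(ip a b (f - f') (derive1n j phi)) -[X in _ = _ * X]/(ip a b (g - g') phi).
by rewrite !ipBl// mulrBr; congr (_ - _); [exact: wg|exact: wg'].
Qed.

Lemma eq_weak_derivative a b j f f' g : {in `]a, b[, f =1 f'} ->
  weak_derivative a b j f g -> weak_derivative a b j f' g.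
Proof.
move=> ff' wd phi tphi; rewrite -wd//; apply: eq_Rintegral => x.
by rewrite inE /= => /ff' ->.
Qed.

(** The integral of [(p phi)'] vanishes, [phi] being zero at both ends. *)
Lemma weak_derivative_poly a b j p : a < b ->
  weak_derivative a b j (horner p) (horner (derivn j p)).
Proof.
move=> ab; elim: j => [|j IH]; first exact: weak_derivative0.
apply: weak_derivative_comp IH _; rewrite derivnS; move: (derivn j p) => {}p phi tphi.
have tphi' := test_function_derive1 tphi.
have Iphi := test_inL2 a b tphi; have Iphi' := test_inL2 a b tphi'.
have dpphi x : is_derive x 1 (horner p * phi) (p.[x] * derive1 phi x + phi x * (deriv p).[x]).
  have dphi : is_derive x 1 phi (derive1 phi x).
    by rewrite derive1E; apply: derivableP; have [d _] := tphi; exact: (d 0).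
  exact: is_deriveM (is_derive_horner p x) dphi.
have cpphi : continuous (fun x => p.[x] * derive1 phi x + phi x * (deriv p).[x]).
  move=> x; apply: cvgD; apply: cvgM.
  - exact: horner_continuous.
  - exact: test_continuous tphi' x.
  - exact: test_continuous tphi x.
  - exact: horner_continuous.
have Icc : mu.-integrable `[a, b]
    (EFin \o (fun x => p.[x] * derive1 phi x + phi x * (deriv p).[x])).
  apply: continuous_compact_integrable; first exact: segment_compact.
  exact: continuous_subspaceT.
have := int_derivative (ltW ab) dpphi cpphi; rewrite !fctE.
have [-> ->] := test_function_endpoints ab tphi; rewrite !mulr0 subr0.
rewrite -Rintegral_itv_obnd_cbnd; last first.
  by apply: integrableS Icc => //; apply: subset_itvr; rewrite bnd_simp.
rewrite -Rintegral_itv_bndo_bndc; last first.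
  by apply: integrableS Icc => //; apply: subset_itv; rewrite bnd_simp.
have E1 := inL2_mul_integrable (inL2_horner a b p) Iphi'.
have E2 := inL2_mul_integrable Iphi (inL2_horner a b (deriv p)).
rewrite RintegralD//; move=> /eqP; rewrite addr_eq0 expr1 mulN1r => /eqP ->.
by congr (- _); exact: ipC.
Qed.

Lemma itv_split a c b : a < c -> c < b ->
  (`]a, b[%classic : set R) = `]a, c] `|` `]c, b[.
Proof. by move=> ac cb; rewrite -itv_bndbnd_setU ?bnd_simp// ltW. Qed.

Lemma measurable_oc a c f : a < c -> measurable_fun `]a, c[ f -> measurable_fun `]a, c] f.
Proof.
move=> ac mf; rewrite -(@setUitv1 _ _ _ _ true) ?bnd_simp//.
by apply/measurable_funU => //; split => //; exact: measurable_fun_set1.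
Qed.

Lemma inL2_glue a c b f : a < c -> c < b -> inL2 a c f -> inL2 c b f -> inL2 a b f.
Proof.
move=> ac cb /inL2P[m1 I1] /inL2P[m2 I2].
have m1' := measurable_oc ac m1.
have mf : measurable_fun `]a, b[ f.
  by rewrite (itv_split ac cb); apply/measurable_funU.
apply/inL2P; split => //; apply/integrableP; split.
  by apply/measurable_EFinP; exact: measurable_funX.
have msq D : measurable_fun D f -> measurable_fun D (fun x => `|f x ^+ 2|%:E).
  move=> mfD; apply/measurable_EFinP; apply: measurableT_comp => //.
  exact: measurable_funX.
rewrite (itv_split ac cb) ge0_integral_setU//=.
- rewrite -integral_itv_bndo_bndc.
    by apply: lte_add_pinfty; [case/integrableP: I1|case/integrableP: I2].
  exact: msq.
- by rewrite -(itv_split ac cb); exact: msq.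
- apply/disj_setPS => y [/=]; rewrite 2!in_itv/= => /andP[_ yx] /andP[].
  by rewrite ltNge yx.
Qed.

Lemma nsq_glue a c b f : a < c -> c < b -> inL2 a b f ->
  nsq a b f = nsq a c f + nsq c b f.
Proof.
move=> ac cb If; have I := inL2_mul_integrable If If.
have := Rintegral_itvB I (_ : (BRight a <= BRight c)%O) (_ : (BRight c <= BLeft b)%O).
rewrite !bnd_simp (ltW ac) cb => /(_ isT isT) H.
rewrite /nsq /ip -H -Rintegral_itv_bndo_bndc; first by rewrite addrC subrK.
by apply: integrableS I => //; apply: subset_itvl; rewrite bnd_simp ltW.
Qed.

End WeakCalculus.

(** * Uniform constants and weights *)

Section UniformEstimate.
Context {R : realType}.
Implicit Types (a b c x : R) (U : nat -> R -> R) (p q : {poly R}) (i j n M m r : nat).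

(** When [M < m] only the order [M] of regularity is available, but then
    [M - 1] is at most [m] and the missing powers go into the constant. *)
Lemma truncation_power m M : (2 <= M)%N -> (0 < m)%N ->
  (M%:R - 1) ^+ (2 * m) <= m%:R ^+ (2 * m) * M%:R ^+ (2 * minn m M) :> R.
Proof.
move=> M2 m0; have M1 : 0 <= M%:R - 1 :> R by rewrite subr_ge0 ler1n; exact: ltnW.
have MM : M%:R - 1 <= M%:R :> R by rewrite gerBl.
have m1 : 1 <= m%:R :> R by rewrite ler1n.
have [mM|Mm] := leqP m M.
  apply: (@le_trans _ _ (M%:R ^+ (2 * m))); first by rewrite lerXn2r// nnegrE.
  by rewrite ler_peMl ?exprn_ge0// exprn_ege1.
apply: (@le_trans _ _ (m%:R ^+ (2 * m))).
  by rewrite lerXn2r ?nnegrE// (le_trans MM)// ler_nat ltnW.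
rewrite ler_peMr ?exprn_ge0// exprn_ege1// ler1n; exact: ltnW.
Qed.

Lemma pred_double M : (2 <= M)%N -> M%:R <= 2 * (M%:R - 1) :> R.
Proof. by move=> M2; have : 2 <= M%:R :> R; [rewrite ler_nat|lra]. Qed.

Lemma sobolev_chain_le a b m m' U : (m' <= m)%N -> sobolev_chain a b m U ->
  sobolev_chain a b m' U.
Proof.
move=> mm [H1 H2]; split=> j jm; first by apply: H1; exact: leq_trans mm.
by apply: H2; exact: leq_trans mm.
Qed.

Lemma sobolev_error_uniform m : exists2 C : R, 0 <= C &
  forall r m' a b M U, (m' <= m)%N -> a < b -> sobolev_chain a b m' U ->
  (1 <= r <= m')%N -> (m' <= M)%N -> (2 <= M)%N ->
  M%:R ^+ (2 * m').+1 * nsq a b (U r - horner (derivn r (cell_proj a b M (U 0)))) <=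
  C * (b - a) ^+ (2 * (m' - r)) * M%:R ^+ (4 * r) * nsq a b (U m').
Proof.
pose good (x : nat * nat) C := 0 <= C /\
  forall a b M U, a < b -> sobolev_chain a b x.2 U -> (1 <= x.1 <= x.2)%N ->
  (x.2 <= M)%N -> (2 <= M)%N ->
  M%:R ^+ (2 * x.2).+1 * nsq a b (U x.1 - horner (derivn x.1 (cell_proj a b M (U 0)))) <=
  C * (b - a) ^+ (2 * (x.2 - x.1)) * M%:R ^+ (4 * x.1) * nsq a b (U x.2).
have ex (x : nat * nat) : exists C, good x C.
  by have [C C0 HC] := @sobolev_error R x.1 x.2; exists C; split.
have [Cf HC] := choice ex.
exists (\sum_(x : 'I_m.+1 * 'I_m.+1) Cf (x.1 : nat, x.2 : nat)).
  by apply: sumr_ge0 => x _; have [] := HC (x.1 : nat, x.2 : nat).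
move=> r m' a b M U m'm ab ch rm mM M2.
have [C0 H] := HC (r, m'); apply: le_trans (H a b M U ab ch rm mM M2) _ => /=.
rewrite ler_wpM2r ?nsq_ge0// ler_wpM2r ?exprn_ge0// ler_wpM2r ?exprn_ge0 ?subr_ge0 ?(ltW ab)//.
have rm1 : (r < m.+1)%N by case/andP: rm => _ rm; rewrite ltnS (leq_trans rm).
have mm1 : (m' < m.+1)%N by rewrite ltnS.
rewrite (bigD1 (Ordinal rm1, Ordinal mm1))//= lerDl; apply: sumr_ge0 => x _.
by have [] := HC (x.1 : nat, x.2 : nat).
Qed.

(** The three cases are the error itself, the derivatives of order at most
    [minn m M], to which the estimates apply with [minn m M] in place of [m],
    and those of higher order, where the projection contributes nothing. *)
Lemma cell_error m : (0 < m)%N -> exists2 K : R, 0 <= K &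
  forall a b M U, a < b -> sobolev_chain a b m U -> (2 <= M)%N ->
  let e j := nsq a b (U j - horner (derivn j (cell_proj a b M (U 0)))) in
  let N := M%:R - 1 in
  [/\ N ^+ (2 * m) * e 0 <= K * (b - a) ^+ (2 * minn m M) * nsq a b (U (minn m M)),
      forall j, (1 <= j <= minn m M)%N -> N ^+ (2 * m).+1 * e j <=
        K * (b - a) ^+ (2 * (minn m M - j)) * N ^+ (4 * j) * nsq a b (U (minn m M)) &
      forall j, (minn m M < j <= m)%N -> N ^+ (2 * m).+1 * e j <= K * nsq a b (U j)].
Proof.
move=> m0; have [C C0 HC] := sobolev_error_uniform m.
have m1 : 1 <= m%:R :> R by rewrite ler1n.
pose A : R := m%:R ^+ (2 * m); have A0 : 0 <= A by exact: exprn_ge0.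
(* One constant for each of the three cases; A comes from truncation_power. *)
pose K1 : R := A * 4 ^+ (m ^ 2); pose K2 := A * C * 16 ^+ m; pose K3 := A * m%:R.
have [K10 K20 K30] : [/\ 0 <= K1, 0 <= K2 & 0 <= K3].
  by split; rewrite ?mulr_ge0 ?exprn_ge0.
exists (K1 + K2 + K3); first by rewrite !addr_ge0.
have [L1 L2 L3] : [/\ K1 <= K1 + K2 + K3, K2 <= K1 + K2 + K3 & K3 <= K1 + K2 + K3].
  by split; lra.
move=> a b M U ab ch M2 e N; set mu := minn m M.
have h0 : 0 <= b - a by rewrite subr_ge0 ltW.
have N1 : 1 <= N by have := @pred_double M M2; have : 2 <= M%:R :> R; [rewrite ler_nat|rewrite /N; lra].
have N0 : 0 <= N by lra.
have NM : N <= M%:R by rewrite gerBl.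
have mum : (mu <= m)%N by exact: geq_minl.
have muM : (mu <= M)%N by exact: geq_minr.
have chmu := sobolev_chain_le mum ch.
have e0 j : 0 <= e j by exact: nsq_ge0.
have V0 j : 0 <= nsq a b (U j) by exact: nsq_ge0.
have trunc := truncation_power M2 m0; rewrite -/N -/mu -/A in trunc.
split.
- apply: le_trans (ler_wpM2r (e0 0) trunc) _; rewrite -[leLHS]mulrA.
  apply: le_trans (ler_wpM2l A0 (jackson ab chmu muM)) _.
  rewrite 2!mulrA ler_wpM2r// ler_wpM2r ?exprn_ge0//; apply: le_trans L1.
  rewrite ler_wpM2l// ler_weXn2l ?ler1n// -!mulnn; exact: leq_mul.
- move=> j jmu; have /andP[j1 jm] := jmu.
  have trunc1 : N ^+ (2 * m).+1 <= A * M%:R ^+ (2 * mu).+1.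
    by rewrite exprSr [M%:R ^+ _.+1]exprSr mulrA ler_pM ?exprn_ge0.
  apply: le_trans (ler_wpM2r (e0 j) trunc1) _; rewrite -[leLHS]mulrA.
  apply: le_trans (ler_wpM2l A0 (HC _ _ _ _ _ _ mum ab chmu jmu muM M2)) _.
  rewrite !mulrA ler_wpM2r//.
  apply: (@le_trans _ _ (A * C * (b - a) ^+ (2 * (mu - j)) * (16 ^+ m * N ^+ (4 * j)))).
    rewrite ler_wpM2l ?mulr_ge0 ?exprn_ge0//.
    apply: (@le_trans _ _ (16 ^+ j * N ^+ (4 * j))).
      have -> : 16 ^+ j * N ^+ (4 * j) = (2 * N) ^+ (4 * j).
        by rewrite exprMn [2 ^+ _]exprM; congr (_ ^+ _ * _); ring.
      by rewrite lerXn2r ?nnegrE ?mulr_ge0//; exact: pred_double.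
    by rewrite ler_wpM2r ?exprn_ge0// ler_weXn2l ?ler1n// (leq_trans jm).
  rewrite mulrA ler_wpM2r ?exprn_ge0// mulrAC ler_wpM2r ?exprn_ge0//.
- move=> j /andP[muj jm].
  have Mm : (M < m)%N.
    rewrite ltnNge; apply/negP => mM; move: muj; rewrite /mu (minn_idPl mM).
    by rewrite ltnNge jm.
  have muE : mu = M by rewrite /mu (minn_idPr (ltnW Mm)).
  rewrite /e derivn_poly0 ?horner0f ?subr0; last first.
    by apply: leq_trans (size_cell_proj ab M (U 0)) _; rewrite -muE; exact: ltnW.
  rewrite ler_wpM2r//; apply: le_trans L3; rewrite /K3 /A exprSr ler_pM ?exprn_ge0//.
    by rewrite lerXn2r ?nnegrE// (le_trans NM)// ler_nat ltnW.
  by rewrite (le_trans NM)// ler_nat ltnW.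
Qed.

(** The length of a cell is [l / D], so that each of its powers yields a weight
    [D ^ (- 2 i)]; those in excess are bounded since [D >= 1]. *)
Lemma cell_error_weighted m (l : R) : (0 < m)%N -> 0 < l -> exists2 K : R, 0 <= K &
  forall a b (D : R) M U, a < b -> 1 <= D -> b - a = l / D ->
  sobolev_chain a b m U -> (2 <= M)%N ->
  let e j := nsq a b (U j - horner (derivn j (cell_proj a b M (U 0)))) in
  let N := M%:R - 1 in
  let S r := \sum_(minn m M <= i < m.+1) D ^+ (2 * r) / D ^+ (2 * i) * nsq a b (U i) in
  N ^+ (2 * m) * e 0 <= K * S 0 /\
  forall r j, (1 <= r <= m)%N -> (j <= r)%N ->
    N ^+ (2 * m).+1 * e j <= K * N ^+ (4 * r) * S r.
Proof.
move=> m0 l0; have [K K0 HK] := cell_error m0.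
pose L := 1 + l; have L1 : 1 <= L by rewrite /L; lra.
have L0 : 0 <= L by lra.
exists (K * L ^+ (2 * m)); first by rewrite mulr_ge0// exprn_ge0.
move=> a b D M U ab D1 hD ch M2 e N S; set mu := minn m M.
have D0 : 0 < D by lra.
have Dp i : 0 < D ^+ i by exact: exprn_gt0.
have [eA eB eC] := HK a b M U ab ch M2; rewrite -/mu -/N in eA eB eC.
have N1 : 1 <= N by have : 2 <= M%:R :> R; [rewrite ler_nat|rewrite /N; lra].
have N0 : 0 <= N by lra.
clearbody N.
have mum : (mu <= m)%N by exact: geq_minl.
have V0 j : 0 <= nsq a b (U j) by exact: nsq_ge0.
have Sterm r i : (mu <= i <= m)%N -> D ^+ (2 * r) / D ^+ (2 * i) * nsq a b (U i) <= S r.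
  move=> /andP[mui im]; rewrite /S (bigD1_seq i) ?iota_uniq ?mem_index_iota ?mui ?ltnS//=.
  by rewrite lerDl; apply: sumr_ge0 => k _; rewrite mulr_ge0// divr_ge0// ltW.
have S0 r : 0 <= S r.
  by apply: le_trans (Sterm r m _); rewrite ?mum ?leqnn// mulr_ge0// divr_ge0// ltW.
have hpow i : (i <= 2 * m)%N -> (b - a) ^+ i <= L ^+ (2 * m) / D ^+ i.
  move=> im; rewrite hD expr_div_n ler_wpM2r ?invr_ge0 ?(ltW (Dp _))//.
  apply: (@le_trans _ _ (L ^+ i)); last by rewrite ler_weXn2l.
  by rewrite lerXn2r ?nnegrE ?(ltW l0)// /L; lra.
have KL0 : 0 <= K * L ^+ (2 * m) by rewrite mulr_ge0// exprn_ge0.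
have bound0 : N ^+ (2 * m) * e 0 <= K * L ^+ (2 * m) * S 0.
  apply: (le_trans eA); apply: (@le_trans _ _ (K * (L ^+ (2 * m) / D ^+ (2 * mu)) * nsq a b (U mu))).
    by rewrite ler_wpM2r// ler_wpM2l// hpow// leq_mul2l.
  rewrite mulrA -mulrA ler_wpM2l//; have := Sterm 0 mu; rewrite leqnn mum => /(_ isT).
  by rewrite muln0 expr0 mul1r.
split=> // r j /andP[r1 rm] jr.
have S0r : S 0 <= S r.
  apply: ler_sum => i _; rewrite ler_wpM2r// ler_wpM2r ?invr_ge0 ?(ltW (Dp _))//.
  by rewrite muln0 expr0 exprn_ege1.
have Nr : N <= N ^+ (4 * r) by rewrite -[leLHS]expr1 ler_weXn2l// muln_gt0.
have [j0|j1] := posnP j.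
  rewrite j0 exprS -mulrA; apply: le_trans (ler_wpM2l N0 bound0) _.
  rewrite mulrCA -!mulrA ler_wpM2l// ler_wpM2l ?exprn_ge0//.
  by rewrite ler_pM.
have [jmu|muj] := leqP j mu.
  have := eB j; rewrite j1 jmu => /(_ isT) H; apply: (le_trans H).
  apply: (@le_trans _ _ (K * (L ^+ (2 * m) / D ^+ (2 * (mu - j))) * N ^+ (4 * r) * nsq a b (U mu))).
    rewrite ler_wpM2r// ler_pM ?mulr_ge0 ?exprn_ge0 ?subr_ge0 ?(ltW ab)//.
      by rewrite ler_wpM2l// hpow// leq_mul2l /= (leq_trans (leq_subr _ _)).
    by rewrite ler_weXn2l// leq_mul2l.
  have -> : K * (L ^+ (2 * m) / D ^+ (2 * (mu - j))) * N ^+ (4 * r) * nsq a b (U mu) =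
      K * L ^+ (2 * m) * N ^+ (4 * r) * (nsq a b (U mu) / D ^+ (2 * (mu - j))) by ring.
  rewrite ler_wpM2l ?mulr_ge0 ?exprn_ge0//.
  have := Sterm r mu; rewrite leqnn mum => /(_ isT); apply: le_trans.
  rewrite [leLHS]mulrC ler_wpM2r//.
  have -> : D ^+ (2 * mu) = D ^+ (2 * (mu - j)) * D ^+ (2 * j).
    by rewrite -exprD -mulnDr subnK.
  rewrite invfM mulrCA ler_peMr ?invr_ge0 ?(ltW (Dp _))// ler_pdivlMr// mul1r.
  by rewrite ler_weXn2l// leq_mul2l.
have jm : (j <= m)%N by exact: leq_trans rm.
have := eC j; rewrite muj jm => /(_ isT) H; apply: (le_trans H).
rewrite -!mulrA ler_wpM2l//.
have LN : 1 <= L ^+ (2 * m) * N ^+ (4 * r) by rewrite -[leLHS]mulr1 ler_pM// exprn_ege1.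
rewrite mulrA; apply: (@le_trans _ _ (1 * S r)); last by rewrite ler_wpM2r.
rewrite mul1r; have := Sterm r j; rewrite (ltnW muj) jm => /(_ isT); apply: le_trans.
by rewrite ler_peMl// ler_pdivlMr// mul1r ler_weXn2l// leq_mul2l.
Qed.

End UniformEstimate.

(** * Wavelets on the dyadic cells *)

Section WaveletCells.
Context {R : realType}.
Variables (l : R) (k : nat) (l0 : 0 < l) (k1 : (1 <= k)%N).
Implicit Types (f g u : R -> R) (x : R) (i j n m M r : nat).
Local Notation mu := (@lebesgue_measure R).
Local Notation bp := (breakpoint l k).
Local Notation Q n := (cell_legendre (bp n) (bp n.+1)).

Lemma breakpoint0 : bp 0 = 0.
Proof. by rewrite /breakpoint !mul0r. Qed.

Lemma breakpoint_last : bp (2 ^ k.-1) = l.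
Proof. by rewrite /breakpoint natrX divff ?mul1r// expf_neq0// pnatr_eq0. Qed.

Lemma breakpoint_le i j : (i <= j)%N -> bp i <= bp j.
Proof.
move=> ij; rewrite /breakpoint ler_pM2r// ler_pM2r ?invr_gt0 ?exprn_gt0//.
by rewrite ler_nat.
Qed.

Lemma breakpoint_lt n : bp n < bp n.+1.
Proof.
rewrite /breakpoint ltr_pM2r// ltr_pM2r ?invr_gt0 ?exprn_gt0//.
by rewrite ltr_nat.
Qed.

Lemma two_exp_pred : 2 ^+ k = 2 * 2 ^+ k.-1 :> R.
Proof. by rewrite -exprS prednK. Qed.

Lemma breakpoint_step n : bp n.+1 - bp n = (2 * l) / 2 ^+ k.
Proof.
rewrite /breakpoint two_exp_pred -natr1; field.
by rewrite expf_neq0// pnatr_eq0.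
Qed.

Definition wavelet_scale i : R :=
  2 `^ (k%:R / 2) * Num.sqrt ((2 * i%:R + 1) / (2 * l)).

Lemma wavelet_scale_sqr n i :
  wavelet_scale i ^+ 2 = (2 * i%:R + 1) / (bp n.+1 - bp n).
Proof.
have odd_ge0 : 0 <= 2 * i%:R + 1 :> R by rewrite addr_ge0// mulr_ge0.
rewrite exprMn sqr_sqrtr ?divr_ge0 ?mulr_ge0 ?(ltW l0)//.
rewrite -powR_mulrn ?powR_ge0// -powRrM divfK ?pnatr_eq0// powR_mulrn//.
rewrite breakpoint_step; field.
by rewrite expf_neq0 ?pnatr_eq0//= gt_eqF.
Qed.

Lemma wavelet_cell n i x : bp n <= x < bp n.+1 ->
  wavelet l k n.+1 i x = wavelet_scale i * (Q n i).[x].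
Proof.
move=> xn; rewrite /wavelet /= xn; congr (_ * _).
rewrite horner_comp cell_chartE breakpoint_step; congr (_.[_]).
rewrite /breakpoint two_exp_pred -natr1; field.
by rewrite expf_neq0 ?pnatr_eq0//= gt_eqF.
Qed.

Lemma wavelet_other n i n' x : bp n < x < bp n.+1 -> (0 < n')%N -> n' != n.+1 ->
  wavelet l k n' i x = 0.
Proof.
move=> /andP[nx xn]; case: n' => // n' _ nn; rewrite /wavelet /= ifF//.
apply/negbTE; rewrite negb_and -ltNge -leNgt.
move: nn; rewrite eqSS neq_ltn => /orP[nn|nn]; apply/orP.
  by right; apply: le_trans (ltW nx); exact: breakpoint_le.
by left; apply: lt_le_trans xn _; exact: breakpoint_le.
Qed.

Lemma wavelet_coef_cell n i f : (n < 2 ^ k.-1)%N -> inL2 (bp n) (bp n.+1) f ->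
  wavelet_coef l k n.+1 i f =
  wavelet_scale i * ip (bp n) (bp n.+1) f (horner (Q n i)).
Proof.
move=> nk If; set a := bp n; set b := bp n.+1.
have ab : a < b by exact: breakpoint_lt.
have a0 : 0 <= a by rewrite -breakpoint0; exact: breakpoint_le.
have bl : b <= l by rewrite -breakpoint_last; exact: breakpoint_le.
pose F x := f x * wavelet l k n.+1 i x.
have Fcell x : x \in `]a, b[ -> F x = wavelet_scale i * (f x * (Q n i).[x]).
  rewrite in_itv /= => /andP[ax xb].
  by rewrite /F wavelet_cell ?(ltW ax)// mulrCA.
have Fout x : x \notin `[a, b[ -> F x = 0.
  by rewrite in_itv /= => xab; rewrite /F /wavelet /= ifN ?mulr0.
have IF : mu.-integrable `]a, b[ (EFin \o F).
  have := integrableZl (measurable_oo a b) (wavelet_scale i)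
    (inL2_mul_integrable If (inL2_horner a b (Q n i))).
  by apply: eq_integrable => // x; rewrite inE /= => /Fcell ->.
rewrite -RintegralZl//; last exact: inL2_mul_integrable (inL2_horner _ _ _).
transitivity (\int[mu]_(x in `]a, b[) F x); last first.
  by apply: eq_Rintegral => x; rewrite inE /= => /Fcell.
rewrite /wavelet_coef; move: a0; rewrite le_eqVlt => /predU1P[a0|a0].
  rewrite Rintegral_mkcond [RHS]Rintegral_mkcond; apply: eq_Rintegral => x _.
  rewrite !patchE !mem_setE; case: (boolP (x \in `]a, b[)) => xab.
    rewrite ifT//; move: xab; rewrite !in_itv /= -a0 => /andP[-> xb].
    exact: lt_le_trans xb bl.
  case: ifP => //; rewrite in_itv /= a0 => /andP[ax _]; apply: Fout.
  by apply: contraNN xab; rewrite !in_itv /= ax => /andP[_ ->].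
rewrite Rintegral_itv_obnd_cbnd// Rintegral_mkcond [RHS]Rintegral_mkcond.
apply: eq_Rintegral => x _; rewrite !patchE !mem_setE.
case: (boolP (x \in `[a, b[)) => [xab|/Fout Fx].
  rewrite ifT//; move: xab; rewrite !in_itv /= => /andP[ax xb].
  by rewrite (lt_le_trans a0 ax) (lt_le_trans xb bl).
by rewrite -/(F x) Fx; case: ifP.
Qed.

(** Only the wavelets of the cell survive, and the square of their scaling factor
    is the inverse of the squared norm of the Legendre polynomial. *)
Lemma wavelet_approx_cell n M f x : (n < 2 ^ k.-1)%N ->
  inL2 (bp n) (bp n.+1) f -> bp n < x < bp n.+1 ->
  wavelet_approx l k M f x = (cell_proj (bp n) (bp n.+1) M f).[x].
Proof.
move=> nk If xn; rewrite /wavelet_approx (bigD1_seq n.+1) ?iota_uniq//=; last first.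
  by rewrite mem_index_iota !ltnS.
rewrite [X in _ + X]big_seq_cond [X in _ + X]big1 ?addr0; last first.
  move=> n'; rewrite mem_index_iota => /andP[/andP[n0 _] nn].
  by apply: big1 => i _; rewrite (wavelet_other _ xn)// mulr0.
have xn' : bp n <= x < bp n.+1 by case/andP: xn => /ltW -> ->.
rewrite /cell_proj horner_sum; apply: eq_bigr => i _.
rewrite wavelet_coef_cell// wavelet_cell// hornerZ -(wavelet_scale_sqr n).
by ring.
Qed.

(** The break points between consecutive cells are negligible. *)
Lemma nsq_cells n f : (0 < n)%N ->
  (forall i, (i < n)%N -> inL2 (bp i) (bp i.+1) f) ->
  inL2 0 (bp n) f /\
  nsq 0 (bp n) f = \sum_(0 <= i < n) nsq (bp i) (bp i.+1) f.
Proof.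
case: n => // n _; elim: n => [|n IH] H.
  by rewrite big_nat1 breakpoint0; split => //; have := H 0%N isT; rewrite breakpoint0.
have [i0 E] := IH (fun i ni => H i (ltnW ni)).
have lt1 : 0 < bp n.+1 by rewrite -breakpoint0; exact: le_lt_trans (breakpoint_le (leq0n n)) (breakpoint_lt n).
have lt2 := breakpoint_lt n.+1; have Il := H n.+1 (leqnn _).
have I : inL2 0 (bp n.+2) f by exact: inL2_glue lt1 lt2 i0 Il.
by split=> //; rewrite (nsq_glue lt1 lt2 I) E [RHS]big_nat_recr.
Qed.

End WaveletCells.

(** * From squared norms to Sobolev norms *)

Section WeakDerivativeChoice.
Context {R : realType}.
Implicit Types (a b : R) (f g : R -> R) (i j n m r M : nat).

Lemma wderivP a b m f j : in_sobolev a b m f -> (j <= m)%N ->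
  inL2 a b (wderiv a b j f) /\ weak_derivative a b j f (wderiv a b j f).
Proof. by move=> [_ H] /H ex; exact: (xgetPex (cst 0) ex). Qed.

Lemma nsq_wderiv a b j f g : inL2 a b g -> weak_derivative a b j f g ->
  inL2 a b (wderiv a b j f) /\ nsq a b (wderiv a b j f) = nsq a b g.
Proof.
move=> Ig wg; have ex : exists g, [set g | inL2 a b g /\ weak_derivative a b j f g] g by exists g.
have [Iw ww] := xgetPex (cst 0) ex; split=> //.
by apply: nsq_null_sub => //; exact: weak_derivative_unique ww wg.
Qed.

Lemma wderiv_chain a b a' b' m f : a <= a' -> a' < b' -> b' <= b ->
  in_sobolev a b m f -> sobolev_chain a' b' m (fun j => wderiv a b j f).
Proof.
move=> aa ab bb sf.
have Iw j : (j <= m)%N -> inL2 a' b' (wderiv a b j f).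
  by move=> jm; have [I _] := wderivP sf jm; exact: inL2_sub I.
split=> // j jm; apply: weak_derivative_pair => //; [exact/Iw/ltnW|exact: Iw|].
have [_ w1] := wderivP sf (ltnW jm); have [_ w2] := wderivP sf jm.
apply: (weak_derivative_quotient (j := j) (f := f)).
  exact: weak_derivative_sub w1.
exact: weak_derivative_sub w2.
Qed.

Lemma eq_cell_proj a b M f g : inL2 a b f -> inL2 a b g -> nsq a b (f - g) = 0 ->
  cell_proj a b M f = cell_proj a b M g.
Proof.
move=> If Ig fg; apply: eq_bigr => i _; congr (_ * _ *: _); apply/eqP.
have Iq := inL2_horner a b (cell_legendre a b i).
by rewrite -subr_eq0 -ipBl// ip_null//; exact: inL2B.
Qed.

(** By uniqueness of weak derivatives, the chosen representatives may be replaced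
    by any others. *)
Lemma sobolev_norm_sqr a b r f (G : nat -> R -> R) : inL2 a b f ->
  (forall j, (j <= r)%N -> inL2 a b (G j) /\ weak_derivative a b j f (G j)) ->
  (sobolev_norm a b r f ^+ 2 = (\sum_(0 <= j < r.+1) nsq a b (G j))%:E)%E.
Proof.
move=> If H; have sf : in_sobolev a b r f by split=> // j jr; exists (G j); exact: H.
rewrite /sobolev_norm asboolT//.
have -> : (\sum_(0 <= j < r.+1) L2norm a b (wderiv a b j f) ^+ 2 =
    (\sum_(0 <= j < r.+1) nsq a b (G j))%:E)%E.
  rewrite -sumEFin big_nat [RHS]big_nat; apply: eq_bigr => j /andP[_ jr].
  have [IG wG] := H j jr; have [Iw <-] := nsq_wderiv IG wG.
  by rewrite L2norm_sqr.
rewrite poweR_EFin powR12_sqrt; last by apply: sumr_ge0 => j _; exact: nsq_ge0.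
rewrite -EFin_expe sqr_sqrtr//; apply: sumr_ge0 => j _; exact: nsq_ge0.
Qed.

(** Back from the squared form, in natural powers, to the stated one. *)
Lemma sqrt_le_powR (X W K N C p : R) (d e : nat) : 0 <= X -> 0 <= W -> 0 < N ->
  0 <= K -> K <= C ^+ 2 -> 0 <= C -> N ^+ d * X <= K * N ^+ e * W ->
  p * 2 = e%:R - d%:R -> Num.sqrt X <= C * N `^ p * Num.sqrt W.
Proof.
move=> X0 W0 N0 K0 KC C0 H pE.
have Np0 : 0 <= N `^ p by exact: powR_ge0.
rewrite -(ler_pXn2r (ltn0Sn 1)) ?nnegrE ?mulr_ge0 ?sqrtr_ge0//.
rewrite !exprMn !sqr_sqrtr// -[N `^ p ^+ 2]powR_mulrn// -powRrM pE.
rewrite powRB; last by rewrite (gt_eqF N0) implybT.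
rewrite !powR_mulrn ?(ltW N0)// !mulrA mulrAC ler_pdivlMr ?exprn_gt0//.
rewrite mulrC; apply: (le_trans H); rewrite ler_wpM2r// ler_wpM2r//.
by rewrite exprn_ge0// ltW.
Qed.

End WeakDerivativeChoice.

Lemma wavelet_seminormE (R : realType) (l : R) (r m M k : nat) (f : R -> R) :
  in_sobolev 0 l m f ->
  wavelet_seminorm l r m M k f = (Num.sqrt (\sum_(minn m M <= i < m.+1)
    (2 ^+ k) ^+ (2 * r) / (2 ^+ k) ^+ (2 * i) * nsq 0 l (wderiv 0 l i f)))%:E.
Proof.
move=> sf; have D0 : 2 ^+ k != 0 :> R by rewrite expf_neq0 ?pnatr_eq0.
rewrite /wavelet_seminorm -powR12_sqrt; last first.
  by apply: sumr_ge0 => i _; rewrite mulr_ge0 ?nsq_ge0// divr_ge0 ?exprn_ge0.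
rewrite -poweR_EFin -sumEFin; congr (_ `^ _)%E.
rewrite big_nat [RHS]big_nat; apply: eq_bigr => i /andP[_ im].
have [Ii _] := wderivP sf (im : (i <= m)%N).
rewrite L2norm_sqr// -EFinM; congr (_ * _)%:E.
by rewrite expfzDr// -!exprnP exprnN.
Qed.

Theorem theorem4p1 (R : realType) (l : R) (m : nat)
    (l_gt0 : 0 < l) (m_ge1 : (1 <= m)%N) :
  exists C : R, 0 < C /\
    forall (f : R -> R), in_sobolev 0 l m f ->
    forall (M k : nat), (2 <= M)%N -> (1 <= k)%N ->
      (L2norm 0 l (fun x => (f x - wavelet_approx l k M f x)%R)
         <= (C * (M%:R - 1) `^ (- m%:R))%:E * wavelet_seminorm l 0 m M k f)%E
      /\
      forall r : nat, (1 <= r <= m)%N ->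
        (broken_sobolev_norm l k r (fun x => (f x - wavelet_approx l k M f x)%R)
           <= (C * (M%:R - 1) `^ (2 * r%:R - 2^-1 - m%:R))%:E
                * wavelet_seminorm l r m M k f)%E.
Proof.
have l2 : 0 < 2 * l by rewrite mulr_gt0.
have [K K0 HK] := @cell_error_weighted R m (2 * l) m_ge1 l2.
have Km0 : 0 <= K * m.+1%:R by rewrite mulr_ge0.
exists (Num.sqrt (K * m.+1%:R) + 1); split; first by rewrite ltr_wpDl ?sqrtr_ge0.
set C := Num.sqrt _ + 1.
have C0 : 0 <= C by rewrite addr_ge0 ?sqrtr_ge0.
have KC2 : K * m.+1%:R <= C ^+ 2.
  rewrite -[leLHS]sqr_sqrtr// lerXn2r ?nnegrE ?sqrtr_ge0//.
  by rewrite lerDl.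
have KC : K <= C ^+ 2 by apply: le_trans KC2; rewrite ler_peMr// ler1n.
move=> f sf M k M2 k1.
pose D : R := 2 ^+ k; pose N : R := M%:R - 1.
have D1 : 1 <= D by rewrite exprn_ege1// ler1n.
have N1 : 1 <= N by have : 2 <= M%:R :> R; [rewrite ler_nat|rewrite /N; lra].
have N0 : 0 < N by exact: lt_le_trans N1.
pose bp := breakpoint l k; pose nc := (2 ^ k.-1)%N.
have nc0 : (0 < nc)%N by rewrite expn_gt0.
pose g j := wderiv 0 l j f.
pose err x := f x - wavelet_approx l k M f x.
pose P n := cell_proj (bp n) (bp n.+1) M (g 0).
pose e n j := nsq (bp n) (bp n.+1) (g j - horner (derivn j (P n))).
pose S r n := \sum_(minn m M <= i < m.+1)
  D ^+ (2 * r) / D ^+ (2 * i) * nsq (bp n) (bp n.+1) (g i).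
have bp_ge0 n : 0 <= bp n by rewrite -(breakpoint0 l k); exact: breakpoint_le.
have bp_le n : (n <= nc)%N -> bp n <= l.
  by move=> ni; rewrite -(breakpoint_last l k); exact: breakpoint_le.
have bp_lt n : bp n < bp n.+1 by exact: breakpoint_lt.
have chain n : (n < nc)%N -> sobolev_chain (bp n) (bp n.+1) m g.
  by move=> ni; apply: wderiv_chain sf => //; exact: bp_le.
have [If _] := sf.
have Ifn n : (n < nc)%N -> inL2 (bp n) (bp n.+1) f.
  by move=> ni; apply: inL2_sub If => //; exact: bp_le.
have fg n : (n < nc)%N -> nsq (bp n) (bp n.+1) (f - g 0) = 0.
  move=> ni; apply: weak_derivative_unique (@weak_derivative0 R _ _ f) _.
  - exact: Ifn.
  - by have [H _] := chain n ni; exact: H.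
  - have [_ w0] := wderivP sf (leq0n m).
    by apply: weak_derivative_sub w0 => //; exact: bp_le.
have PE n : (n < nc)%N -> cell_proj (bp n) (bp n.+1) M f = P n.
  move=> ni; apply: eq_cell_proj; [exact: Ifn| |exact: fg].
  by have [H _] := chain n ni; exact: H.
have errE n : (n < nc)%N -> {in `]bp n, bp n.+1[, err =1 f - horner (P n)}.
  move=> ni x; rewrite in_itv /= => xn; rewrite /err -PE//.
  by rewrite (wavelet_approx_cell l_gt0 k1 M ni (Ifn n ni) xn).
have errE' n : (n < nc)%N -> {in `]bp n, bp n.+1[, f - horner (P n) =1 err}.
  by move=> ni x xn; rewrite (errE n ni x xn).
have Ierr n : (n < nc)%N -> inL2 (bp n) (bp n.+1) err.
  move=> ni; apply: eq_inL2 (errE' n ni) _; apply: inL2B; first exact: Ifn.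
  exact: inL2_horner.
have werr n j : (n < nc)%N -> (j <= m)%N ->
    inL2 (bp n) (bp n.+1) (g j - horner (derivn j (P n))) /\
    weak_derivative (bp n) (bp n.+1) j err (g j - horner (derivn j (P n))).
  move=> ni jm; have [Ig _] := chain n ni.
  have [Igj Ip] := (Ig j jm, inL2_horner (bp n) (bp n.+1) (derivn j (P n))).
  split; first exact: inL2B.
  apply: eq_weak_derivative (errE' n ni) _; apply: weak_derivativeB => //.
  - exact: Ifn.
  - exact: inL2_horner.
  - have [_ wj] := wderivP sf jm.
    by apply: weak_derivative_sub wj => //; exact: bp_le.
  - exact: weak_derivative_poly.
have e0E n : (n < nc)%N -> nsq (bp n) (bp n.+1) err = e n 0.
  move=> ni; have [Ie we] := werr n 0 ni (leq0n m).
  apply: nsq_null_sub => //; first exact: Ierr.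
  exact: weak_derivative_unique (Ierr n ni) Ie (@weak_derivative0 R _ _ _) we.
have est n : (n < nc)%N -> N ^+ (2 * m) * e n 0 <= K * S 0 n /\
    forall r j, (1 <= r <= m)%N -> (j <= r)%N ->
    N ^+ (2 * m).+1 * e n j <= K * N ^+ (4 * r) * S r n.
  move=> ni; apply: (HK (bp n) (bp n.+1) D M g (bp_lt n) D1 _ (chain n ni) M2).
  exact: breakpoint_step.
have SE r : \sum_(minn m M <= i < m.+1)
    D ^+ (2 * r) / D ^+ (2 * i) * nsq 0 l (g i) = \sum_(0 <= n < nc) S r n.
  rewrite exchange_big /= big_nat [RHS]big_nat; apply: eq_bigr => i /andP[_ im].
  rewrite -mulr_sumr; congr (_ * _).
  have [_ <-] := nsq_cells l_gt0 nc0 (fun n ni => (chain n ni).1 i im).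
  by rewrite (breakpoint_last l k).
have S0 r : 0 <= \sum_(0 <= n < nc) S r n.
  apply: sumr_ge0 => n _; apply: sumr_ge0 => i _.
  by rewrite mulr_ge0 ?nsq_ge0// divr_ge0 ?exprn_ge0.
split.
  have [Il El] := nsq_cells l_gt0 nc0 Ierr.
  rewrite (breakpoint_last l k) in Il El.
  rewrite wavelet_seminormE// SE -/err L2norm_nsq// -EFinM lee_fin.
  apply: (@sqrt_le_powR _ _ _ K N C _ (2 * m) 0) => //; first exact: nsq_ge0.
    rewrite El expr0 mulr1 !mulr_sumr; apply: ler_sum_nat => n /andP[_ ni].
    by rewrite e0E//; have [] := est n ni.
  by rewrite mulr0n sub0r natrM mulNr mulrC.
move=> r /andP[r1 rm].
have -> : broken_sobolev_norm l k r err =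
    (Num.sqrt (\sum_(0 <= n < nc) \sum_(0 <= j < r.+1) e n j))%:E.
  have T0 : 0 <= \sum_(0 <= n < nc) \sum_(0 <= j < r.+1) e n j.
    by apply: sumr_ge0 => n _; apply: sumr_ge0 => j _; exact: nsq_ge0.
  rewrite -powR12_sqrt// -poweR_EFin -sumEFin /broken_sobolev_norm; congr (_ `^ _)%E.
  rewrite big_add1 big_nat [RHS]big_nat; apply: eq_bigr => n /andP[_ ni].
  apply: sobolev_norm_sqr; first exact: Ierr.
  by move=> j jr; apply: werr => //; exact: leq_trans rm.
rewrite wavelet_seminormE// SE -EFinM lee_fin.
apply: (@sqrt_le_powR _ _ _ (K * m.+1%:R) N C _ (2 * m).+1 (4 * r)) => //.
- by apply: sumr_ge0 => n _; apply: sumr_ge0 => j _; exact: nsq_ge0.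
- rewrite !mulr_sumr; apply: ler_sum_nat => n /andP[_ ni].
  rewrite mulr_sumr; have [_ H] := est n ni.
  apply: (@le_trans _ _ (\sum_(0 <= j < r.+1) K * N ^+ (4 * r) * S r n)).
    by apply: ler_sum_nat => j /andP[_ jr]; apply: H => //; rewrite r1.
  rewrite sumr_const_nat subn0 -[leLHS]mulr_natr.
  have -> : K * m.+1%:R * N ^+ (4 * r) * S r n = K * N ^+ (4 * r) * S r n * m.+1%:R by ring.
  rewrite ler_wpM2l ?ler_nat// !mulr_ge0 ?exprn_ge0 ?(ltW N0)//.
  apply: sumr_ge0 => i _.
  by rewrite mulr_ge0 ?nsq_ge0// divr_ge0 ?exprn_ge0.
- rewrite -[(2 * m).+1%:R]natr1 !natrM; lra.
Qed.
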